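(* Let $M$ be a $(2n+1)$-dimensional $N(\kappa)$-contact metric manifold which is quasi-$\mathcal{T}$-flat, i.e. $g(\mathcal{T}(\varphi X_1,X_2)X_3,\varphi X_4)=0$ for all vector fields $X_1,\dots,X_4$, and suppose $C_1=a_0+2na_1+a_2+a_3+a_5+a_6\neq0$. Then $$S=\frac{A_1}{C_1}\,g+\frac{B_1}{C_1}\,\eta\otimes\eta,$$ where $A_1=a_0\kappa+a_4(2n\kappa-r)+a_7r(1-2n)$ and $B_1=-a_0\kappa+2n\kappa(a_2+a_3+a_5+a_6)-a_7r$. Therefore $M$ is an $\eta$-Einstein manifold. Consequently, for $\mathcal{T}$ equal to each of the following special tensors (whenever the corresponding $C_1\ne0$), quasi-flatness implies that $S$ has the stated form (so $M$ is Einstein when the $\eta\otimes\eta$ term is absent, and $\eta$-Einstein otherwise): - $\mathcal{C}_\star$: $S=\dfrac{\frac{(2n-1)(\kappa+2n-2)(4na_1+a_0)}{2n+1}+a_0\kappa-4n(n-1)a_1}{2a_1(n-1)+a_0}\,g+\dfrac{\kappa(-8n^2a_1-2na_0)+2(n-1)(4na_1+a_0)}{(2n+1)(2a_1(n-1)+a_0)}\,\eta\otimes\eta$; - $\mathcal{C}$: $S=(2n-2)g+2(n\kappa-n+1)\eta\otimes\eta$; - $\mathcal{L}$: $S=(\kappa(2n-1)+4n(n-1))g+(2n\kappa+\kappa)\eta\otimes\eta$; - $\mathcal{V}$: $S=\frac{2n(2n-3+2\kappa)+2}{2n+1}g+\frac{2n-2n\kappa-2}{2n+1}\eta\otimes\eta$;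 - $\mathcal{P}_\star$: $S=\dfrac{\frac{(2n-1)(\kappa+2n-2)(2na_1+a_0)}{2n+1}+\kappa a_0}{a_1(2n-1)+a_0}\,g-\dfrac{2((\kappa-1)n+1)(2na_1+a_0)}{(2n+1)(a_1(2n-1)+a_0)}\,\eta\otimes\eta$; - $\mathcal{P},\mathcal{W}_0,\mathcal{W}_1^\star,\mathcal{W}_6,\mathcal{W}_8$: $S=2n\kappa\,g$; - $\mathcal{M}$: $S=\frac{2n(\kappa+n-1)}{n+1}g$; - $\mathcal{W}_0^\star,\mathcal{W}_1$: $S=\frac{2n\kappa}{4n-1}g+\frac{4n\kappa}{1-4n}\eta\otimes\eta$; - $\mathcal{W}_2,\mathcal{W}_9$: $S=\frac{2n(2n-2+\kappa)}{2n+1}g$; - $\mathcal{W}_3$: $S=\frac{2n(2-2n+\kappa)}{2n-1}g-\frac{4n\kappa}{2n-1}\eta\otimes\eta$; - $\mathcal{W}_4,\mathcal{W}_5$: $S=\kappa g-\kappa\,\eta\otimes\eta$.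
   Context: A contact metric manifold $(M^{2n+1},\varphi,\xi,\eta,g)$ satisfies $\varphi^2=-I+\eta\otimes\xi$, $\eta(\xi)=1$, $\varphi\xi=0$, $\eta\circ\varphi=0$, $g(\varphi X,\varphi Y)=g(X,Y)-\eta(X)\eta(Y)$, $d\eta(X,Y)=g(X,\varphi Y)$; put $h=\tfrac12\mathcal{L}_\xi\varphi$. It is an $N(\kappa)$-contact metric manifold ($\kappa$ a real constant) if $R(X,Y)\xi=\kappa[\eta(Y)X-\eta(X)Y]$ for all $X,Y$, where $R(X,Y)Z=\nabla_X\nabla_YZ-\nabla_Y\nabla_XZ-\nabla_{[X,Y]}Z$. $S$, $Q$, $r$ denote the Ricci tensor, the Ricci operator ($S(X,Y)=g(QX,Y)$) and the scalar curvature. $M$ is $\eta$-Einstein if $S=b_1g+b_2\,\eta\otimes\eta$ with $b_1,b_2$ smooth functions, and Einstein if moreover $b_2=0$. Standing formulas the paper uses for every $N(\kappa)$-contact metric manifold considered: $S(X,Y)=2(n-1)g(X,Y)+2(n-1)g(hX,Y)+[2n\kappa-2(n-1)]\eta(X)\eta(Y)$, $S(X,\xi)=2n\kappa\,\eta(X)$, $r=2n(2n-2+\kappa)$. The $\mathcal{T}$-curvature tensor with coefficients $a_0,\dots,a_7$ (smooth functions on $M$) is $$\mathcal{T}(X_1,X_2)X_3=a_0R(X_1,X_2)X_3+a_1S(X_2,X_3)X_1+a_2S(X_1,X_3)X_2+a_3S(X_1,X_2)X_3+a_4g(X_2,X_3)QX_1+a_5g(X_1,X_3)QX_2+a_6g(X_1,X_2)QX_3+a_7r\bigl(g(X_2,X_3)X_1-g(X_1,X_3)X_2\bigr).$$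 Special cases (coefficients not listed are $0$; $a_0=1$ except for $\mathcal{C}_\star,\mathcal{P}_\star$, where $a_0,a_1$ are free): $\mathcal{C}_\star$ (quasi-conformal): $a_1=-a_2=a_4=-a_5$, $a_7=-\frac1{2n+1}(\frac{a_0}{2n}+2a_1)$; $\mathcal{C}$ (conformal): $a_1=-a_2=a_4=-a_5=-\frac1{2n-1}$, $a_7=\frac1{2n(2n-1)}$; $\mathcal{L}$ (conharmonic): $a_1=-a_2=a_4=-a_5=-\frac1{2n-1}$; $\mathcal{V}$ (concircular): $a_7=-\frac1{2n(2n+1)}$; $\mathcal{P}_\star$ (pseudo-projective): $a_1=-a_2$, $a_7=-\frac1{2n+1}(\frac{a_0}{2n}+a_1)$; $\mathcal{P}$ (projective): $a_1=-a_2=-\frac1{2n}$; $\mathcal{M}$ ($M$-projective): $a_1=-a_2=a_4=-a_5=-\frac1{4n}$; $\mathcal{W}_0$: $a_1=-a_5=-\frac1{2n}$; $\mathcal{W}_0^\star$: $a_1=-a_5=\frac1{2n}$; $\mathcal{W}_1$: $a_1=-a_2=\frac1{2n}$; $\mathcal{W}_1^\star$: $a_1=-a_2=-\frac1{2n}$; $\mathcal{W}_2$: $a_4=-a_5=-\frac1{2n}$; $\mathcal{W}_3$: $a_2=-a_4=-\frac1{2n}$; $\mathcal{W}_4$: $a_5=-a_6=\frac1{2n}$; $\mathcal{W}_5$: $a_2=-a_5=-\frac1{2n}$; $\mathcal{W}_6$: $a_1=-a_6=-\frac1{2n}$; $\mathcal{W}_8$: $a_1=-a_3=-\frac1{2n}$;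 $\mathcal{W}_9$: $a_3=-a_4=\frac1{2n}$. *)

(* Defs.v *)
From mathcomp Require Export all_boot all_order all_algebra.
From mathcomp Require Export all_classical all_reals all_analysis.
Export Order.TTheory GRing.Theory Num.Theory numFieldNormedType.Exports.

Set Implicit Arguments.
Unset Strict Implicit.
Unset Printing Implicit Defensive.

Global Open Scope classical_set_scope.
Global Open Scope ring_scope.

Fixpoint iter_partial (R : realType) (m : nat) (W : normedModType R)
    (s : seq 'I_m) (f : 'rV[R]_m -> W) : 'rV[R]_m -> W :=
  if s is i :: s' then 'D_(delta_mx 0 i) (iter_partial s' f) else f.

(* For [A] open this is C^oo regularity: every iterated partial derivative is
   Frechet differentiable, hence continuous, at every point of [A]. *)
Definition smooth_on (R : realType) (m : nat) (W : normedModType R)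
    (f : 'rV[R]_m -> W) (A : set 'rV[R]_m) : Prop :=
  forall (s : seq 'I_m) (x : 'rV[R]_m), A x ->
    differentiable (iter_partial s f) x.

(* A smooth m-dimensional manifold (Hausdorff, second countable).  The atlas is
   indexed by the points of [M]: [coord p], defined on [dom p], is a chart
   around [p], the preferred chart at [p].  Every smooth structure has an atlas
   of this form.  [inv p] is the inverse of [coord p]; its values off
   [coord p @` dom p] are irrelevant. *)
Record manifold (R : realType) (m : nat) (M : topologicalType) := Manifold {
  dom : M -> set M;
  coord : M -> M -> 'rV[R]_m;
  inv : M -> 'rV[R]_m -> M;
  manifold_hausdorff : hausdorff_space M;
  manifold_second_countable : @second_countable M;
  dom_open : forall p, open (dom p);
  dom_center : forall p, dom p p;
  coordK : forall p q, dom p q -> inv p (coord p q) = q;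
  coord_open : forall p, open (coord p @` dom p);
  coord_continuous : forall p q, dom p q -> {for q, continuous (coord p)};
  inv_continuous : forall p u, (coord p @` dom p) u ->
    {for u, continuous (inv p)};
  transition_smooth : forall p q,
    smooth_on (coord q \o inv p) (coord p @` (dom p `&` dom q))
}.

(* The tangent space at [p] is 'rV[R]_m, a tangent vector being given by its
   components in the preferred chart at [p]; a vector field is thus a map
   M -> 'rV[R]_m.  Fields that matter on an open set [U] only are total maps
   whose values off [U] are irrelevant. *)

(* X F, the derivative of F along X. *)
Definition dirD (R : realType) (m : nat) (M : topologicalType)
    (A : manifold R m M) (W : normedModType R)
    (X : M -> 'rV[R]_m) (F : M -> W) : M -> W :=
  fun q => 'D_(X q) (F \o inv A q) (coord A q q).

Definition smooth_map (R : realType) (m : nat) (M : topologicalType)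
    (A : manifold R m M) (W : normedModType R) (U : set M) (F : M -> W) :
    Prop :=
  forall p, smooth_on (F \o inv A p) (coord A p @` (dom A p `&` U)).

Definition smooth_fun (R : realType) (m : nat) (M : topologicalType)
    (A : manifold R m M) (U : set M) (f : M -> R) : Prop :=
  smooth_map A U (f : M -> R^o).

(* [dirD A X (coord A p)] lists the components of [X] in the chart
   centred at [p], a fixed chart, unlike the preferred chart at a moving point. *)
Definition smooth_field (R : realType) (m : nat) (M : topologicalType)
    (A : manifold R m M) (U : set M) (X : M -> 'rV[R]_m) : Prop :=
  forall p, smooth_map A (dom A p `&` U) (dirD A X (coord A p)).

(* [X, Y] f = X (Y f) - Y (X f), applied to the coordinate functions of the
   preferred chart at the base point. *)
Definition lie_bracket (R : realType) (m : nat) (M : topologicalType)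
    (A : manifold R m M) (X Y : M -> 'rV[R]_m) : M -> 'rV[R]_m :=
  fun p => dirD A X (dirD A Y (coord A p)) p
         - dirD A Y (dirD A X (coord A p)) p.

(* An endomorphism field acts on row vectors from the right; a 1-form is a
   field of column vectors; a (0,2)-tensor is given by its Gram matrices. *)
Definition endo (R : realType) (m : nat) (M : topologicalType)
    (phi : M -> 'M[R]_m) (p : M) (x : 'rV[R]_m) : 'rV[R]_m := x *m phi p.

Definition form1 (R : realType) (m : nat) (M : topologicalType)
    (eta : M -> 'cV[R]_m) (p : M) (x : 'rV[R]_m) : R := (x *m eta p) 0 0.

Definition form2 (R : realType) (m : nat) (M : topologicalType)
    (g : M -> 'M[R]_m) (p : M) (x y : 'rV[R]_m) : R :=
  (x *m g p *m y^T) 0 0.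

Record riemannian (R : realType) (m : nat) (M : topologicalType)
    (A : manifold R m M) (g : M -> 'M[R]_m) : Prop := Riemannian {
  metric_smooth : forall (U : set M) (X Y : M -> 'rV[R]_m), open U ->
    smooth_field A U X -> smooth_field A U Y ->
    smooth_fun A U (fun p => form2 g p (X p) (Y p));
  metric_sym : forall p x y, form2 g p x y = form2 g p y x;
  metric_pos : forall p x, x != 0 -> 0 < form2 g p x x
}.

(* The Levi-Civita connection, acting on vector fields over open subsets. *)
Record levi_civita (R : realType) (m : nat) (M : topologicalType)
    (A : manifold R m M) (g : M -> 'M[R]_m)
    (nabla : (M -> 'rV[R]_m) -> (M -> 'rV[R]_m) -> (M -> 'rV[R]_m)) : Prop :=
  LeviCivita {
  nabla_local : forall (U : set M) (X X' Y Y' : M -> 'rV[R]_m), open U ->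
    smooth_field A U X -> smooth_field A U Y ->
    (forall p, U p -> X p = X' p) -> (forall p, U p -> Y p = Y' p) ->
    forall p, U p -> nabla X Y p = nabla X' Y' p;
  nabla_smooth : forall (U : set M) (X Y : M -> 'rV[R]_m), open U ->
    smooth_field A U X -> smooth_field A U Y -> smooth_field A U (nabla X Y);
  nablaDl : forall (U : set M) (X X' Y : M -> 'rV[R]_m), open U ->
    smooth_field A U X -> smooth_field A U X' -> smooth_field A U Y ->
    forall p, U p ->
      nabla (fun q => X q + X' q) Y p = nabla X Y p + nabla X' Y p;
  nablaZl : forall (U : set M) (f : M -> R) (X Y : M -> 'rV[R]_m), open U ->
    smooth_fun A U f -> smooth_field A U X -> smooth_field A U Y ->
    forall p, U p -> nabla (fun q => f q *: X q) Y p = f p *: nabla X Y p;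
  nablaDr : forall (U : set M) (X Y Y' : M -> 'rV[R]_m), open U ->
    smooth_field A U X -> smooth_field A U Y -> smooth_field A U Y' ->
    forall p, U p ->
      nabla X (fun q => Y q + Y' q) p = nabla X Y p + nabla X Y' p;
  nabla_leibniz : forall (U : set M) (f : M -> R) (X Y : M -> 'rV[R]_m),
    open U ->
    smooth_fun A U f -> smooth_field A U X -> smooth_field A U Y ->
    forall p, U p -> nabla X (fun q => f q *: Y q) p
      = dirD A X (f : M -> R^o) p *: Y p + f p *: nabla X Y p;
  nabla_torsion_free : forall (U : set M) (X Y : M -> 'rV[R]_m), open U ->
    smooth_field A U X -> smooth_field A U Y ->
    forall p, U p -> nabla X Y p - nabla Y X p = lie_bracket A X Y p;
  nabla_metric : forall (U : set M) (X Y Z : M -> 'rV[R]_m), open U ->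
    smooth_field A U X -> smooth_field A U Y -> smooth_field A U Z ->
    forall p, U p ->
      dirD A X ((fun q => form2 g q (Y q) (Z q)) : M -> R^o) p
      = form2 g p (nabla X Y p) (Z p) + form2 g p (Y p) (nabla X Z p)
}.

(* [Rm] is the (1,3)-tensor field with
   R(X,Y)Z = nabla_X nabla_Y Z - nabla_Y nabla_X Z - nabla_[X,Y] Z. *)
Definition curvature_tensor (R : realType) (m : nat) (M : topologicalType)
    (A : manifold R m M)
    (nabla : (M -> 'rV[R]_m) -> (M -> 'rV[R]_m) -> (M -> 'rV[R]_m))
    (Rm : M -> 'rV[R]_m -> 'rV[R]_m -> 'rV[R]_m -> 'rV[R]_m) : Prop :=
  forall (U : set M) (X Y Z : M -> 'rV[R]_m), open U ->
    smooth_field A U X -> smooth_field A U Y -> smooth_field A U Z ->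
    forall p, U p ->
      Rm p (X p) (Y p) (Z p)
      = nabla X (nabla Y Z) p - nabla Y (nabla X Z) p
        - nabla (lie_bracket A X Y) Z p.

(* S(y,z) = trace of x |-> R(x,y)z. *)
Definition ricci (R : realType) (m : nat) (M : topologicalType)
    (Rm : M -> 'rV[R]_m -> 'rV[R]_m -> 'rV[R]_m -> 'rV[R]_m)
    (p : M) (y z : 'rV[R]_m) : R :=
  \tr (lin1_mx (fun x => Rm p x y z)).

(* Q is the endomorphism field with S(x,y) = g(Qx,y): in matrices acting on row
   vectors, Q g is the Gram matrix of S. *)
Definition ricci_op (R : realType) (m : nat) (M : topologicalType)
    (g : M -> 'M[R]_m)
    (Rm : M -> 'rV[R]_m -> 'rV[R]_m -> 'rV[R]_m -> 'rV[R]_m) : M -> 'M[R]_m :=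
  fun p => (\matrix_(i, j) ricci Rm p (delta_mx 0 i) (delta_mx 0 j))
           *m invmx (g p).

Definition scalar_curvature (R : realType) (m : nat) (M : topologicalType)
    (g : M -> 'M[R]_m)
    (Rm : M -> 'rV[R]_m -> 'rV[R]_m -> 'rV[R]_m -> 'rV[R]_m) (p : M) : R :=
  \tr (ricci_op g Rm p).

(* The exterior derivative is normalised by
   2 d eta(X,Y) = X eta(Y) - Y eta(X) - eta([X,Y]), the usual convention for
   contact metric structures; it is the one for which Sasakian manifolds
   satisfy R(X,Y) xi = eta(Y) X - eta(X) Y. *)
Definition d_eta (R : realType) (m : nat) (M : topologicalType)
    (A : manifold R m M) (eta : M -> 'cV[R]_m) (X Y : M -> 'rV[R]_m) (p : M) :
    R :=
  2^-1 * (dirD A X ((fun q => form1 eta q (Y q)) : M -> R^o) p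
        - dirD A Y ((fun q => form1 eta q (X q)) : M -> R^o) p
        - form1 eta p (lie_bracket A X Y p)).

Record contact_metric (R : realType) (m : nat) (M : topologicalType)
    (A : manifold R m M) (phi : M -> 'M[R]_m) (xi : M -> 'rV[R]_m)
    (eta : M -> 'cV[R]_m) (g : M -> 'M[R]_m) : Prop := ContactMetric {
  phi_smooth : forall (U : set M) (X : M -> 'rV[R]_m), open U ->
    smooth_field A U X -> smooth_field A U (fun p => endo phi p (X p));
  xi_smooth : smooth_field A setT xi;
  eta_smooth : forall (U : set M) (X : M -> 'rV[R]_m), open U ->
    smooth_field A U X -> smooth_fun A U (fun p => form1 eta p (X p));
  g_riemannian : riemannian A g;
  phi_sqr : forall p x,
    endo phi p (endo phi p x) = - x + form1 eta p x *: xi p;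
  eta_xi : forall p, form1 eta p (xi p) = 1;
  phi_xi : forall p, endo phi p (xi p) = 0;
  eta_phi : forall p x, form1 eta p (endo phi p x) = 0;
  g_phi : forall p x y, form2 g p (endo phi p x) (endo phi p y)
    = form2 g p x y - form1 eta p x * form1 eta p y;
  contact_condition : forall (U : set M) (X Y : M -> 'rV[R]_m), open U ->
    smooth_field A U X -> smooth_field A U Y ->
    forall p, U p ->
      d_eta A eta X Y p = form2 g p (X p) (endo phi p (Y p))
}.

(* h = (1/2) L_xi phi, where (L_xi phi) X = [xi, phi X] - phi [xi, X]. *)
Definition half_lie_phi (R : realType) (m : nat) (M : topologicalType)
    (A : manifold R m M) (phi : M -> 'M[R]_m) (xi : M -> 'rV[R]_m)
    (h : M -> 'M[R]_m) : Prop :=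
  forall (U : set M) (X : M -> 'rV[R]_m), open U -> smooth_field A U X ->
    forall p, U p ->
      endo h p (X p)
      = 2^-1 *: (lie_bracket A xi (fun q => endo phi q (X q)) p
                 - endo phi p (lie_bracket A xi X p)).

Definition N_contact (R : realType) (m : nat) (M : topologicalType)
    (xi : M -> 'rV[R]_m) (eta : M -> 'cV[R]_m)
    (Rm : M -> 'rV[R]_m -> 'rV[R]_m -> 'rV[R]_m -> 'rV[R]_m) (kappa : R) :
    Prop :=
  forall p x y,
    Rm p x y (xi p) = kappa *: (form1 eta p y *: x - form1 eta p x *: y).

(* For kappa < 1 these are theorems.  For kappa = 1 (Sasakian manifolds) the
   first and the third are genuine assumptions. *)
Record standing_formulas (R : realType) (n m : nat) (M : topologicalType)
    (xi : M -> 'rV[R]_m) (eta : M -> 'cV[R]_m) (g h : M -> 'M[R]_m)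
    (Rm : M -> 'rV[R]_m -> 'rV[R]_m -> 'rV[R]_m -> 'rV[R]_m) (kappa : R) :
    Prop := StandingFormulas {
  ricci_formula : forall p x y, ricci Rm p x y
    = 2 * (n%:R - 1) * form2 g p x y
      + 2 * (n%:R - 1) * form2 g p (endo h p x) y
      + (2 * n%:R * kappa - 2 * (n%:R - 1)) * (form1 eta p x * form1 eta p y);
  ricci_xi_formula : forall p x,
    ricci Rm p x (xi p) = 2 * n%:R * kappa * form1 eta p x;
  scalar_formula : forall p,
    scalar_curvature g Rm p = 2 * n%:R * (2 * n%:R - 2 + kappa)
}.

Definition ricci_form (R : realType) (m : nat) (M : topologicalType)
    (eta : M -> 'cV[R]_m) (g : M -> 'M[R]_m)
    (Rm : M -> 'rV[R]_m -> 'rV[R]_m -> 'rV[R]_m -> 'rV[R]_m)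
    (b1 b2 : M -> R) : Prop :=
  forall p x y, ricci Rm p x y
    = b1 p * form2 g p x y + b2 p * (form1 eta p x * form1 eta p y).

Definition eta_einstein (R : realType) (m : nat) (M : topologicalType)
    (A : manifold R m M) (eta : M -> 'cV[R]_m) (g : M -> 'M[R]_m)
    (Rm : M -> 'rV[R]_m -> 'rV[R]_m -> 'rV[R]_m -> 'rV[R]_m) : Prop :=
  exists b1 b2 : M -> R,
    [/\ smooth_fun A setT b1, smooth_fun A setT b2
      & ricci_form eta g Rm b1 b2].

Definition einstein (R : realType) (m : nat) (M : topologicalType)
    (A : manifold R m M) (eta : M -> 'cV[R]_m) (g : M -> 'M[R]_m)
    (Rm : M -> 'rV[R]_m -> 'rV[R]_m -> 'rV[R]_m -> 'rV[R]_m) : Prop :=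
  exists b1 : M -> R,
    smooth_fun A setT b1 /\ ricci_form eta g Rm b1 (fun=> 0).

Record tcoef (R : realType) (M : topologicalType) := TCoef {
  a0 : M -> R; a1 : M -> R; a2 : M -> R; a3 : M -> R;
  a4 : M -> R; a5 : M -> R; a6 : M -> R; a7 : M -> R
}.

Definition smooth_tcoef (R : realType) (m : nat) (M : topologicalType)
    (A : manifold R m M) (c : tcoef R M) : Prop :=
  (smooth_fun A setT (a0 c) /\ smooth_fun A setT (a1 c) /\
   smooth_fun A setT (a2 c) /\ smooth_fun A setT (a3 c)) /\
  (smooth_fun A setT (a4 c) /\ smooth_fun A setT (a5 c) /\
   smooth_fun A setT (a6 c) /\ smooth_fun A setT (a7 c)).

Definition T_tensor (R : realType) (m : nat) (M : topologicalType)
    (g : M -> 'M[R]_m)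
    (Rm : M -> 'rV[R]_m -> 'rV[R]_m -> 'rV[R]_m -> 'rV[R]_m) (c : tcoef R M)
    (p : M) (x1 x2 x3 : 'rV[R]_m) : 'rV[R]_m :=
  let S := ricci Rm p in
  let G := form2 g p in
  let Q := endo (ricci_op g Rm) p in
  let r := scalar_curvature g Rm p in
  a0 c p *: Rm p x1 x2 x3
  + (a1 c p * S x2 x3) *: x1
  + (a2 c p * S x1 x3) *: x2
  + (a3 c p * S x1 x2) *: x3
  + (a4 c p * G x2 x3) *: Q x1
  + (a5 c p * G x1 x3) *: Q x2
  + (a6 c p * G x1 x2) *: Q x3
  + (a7 c p * r) *: (G x2 x3 *: x1 - G x1 x3 *: x2).

Definition quasi_T_flat (R : realType) (m : nat) (M : topologicalType)
    (phi : M -> 'M[R]_m) (g : M -> 'M[R]_m)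
    (Rm : M -> 'rV[R]_m -> 'rV[R]_m -> 'rV[R]_m -> 'rV[R]_m) (c : tcoef R M) :
    Prop :=
  forall p x1 x2 x3 x4,
    form2 g p (T_tensor g Rm c p (endo phi p x1) x2 x3) (endo phi p x4) = 0.

Definition C1 (R : realType) (M : topologicalType) (n : nat) (c : tcoef R M)
    (p : M) : R :=
  a0 c p + 2 * n%:R * a1 c p + a2 c p + a3 c p + a5 c p + a6 c p.

Definition A1 (R : realType) (M : topologicalType) (n : nat) (kappa : R)
    (r : M -> R) (c : tcoef R M) (p : M) : R :=
  a0 c p * kappa + a4 c p * (2 * n%:R * kappa - r p)
  + a7 c p * r p * (1 - 2 * n%:R).

Definition B1 (R : realType) (M : topologicalType) (n : nat) (kappa : R)
    (r : M -> R) (c : tcoef R M) (p : M) : R :=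
  - (a0 c p * kappa)
  + 2 * n%:R * kappa * (a2 c p + a3 c p + a5 c p + a6 c p)
  - a7 c p * r p.

Definition const_tcoef (R : realType) (M : topologicalType)
    (c0 c1 c2 c3 c4 c5 c6 c7 : R) : tcoef R M :=
  TCoef (fun=> c0) (fun=> c1) (fun=> c2) (fun=> c3)
        (fun=> c4) (fun=> c5) (fun=> c6) (fun=> c7).

Section SpecialCoefficients.
Context (R : realType) (M : topologicalType) (n : nat).
Local Notation N := (n%:R : R).
Local Notation const := (const_tcoef M).

Definition quasi_conformal (b0 b1 : M -> R) : tcoef R M :=
  TCoef b0 b1 (fun p => - b1 p) (fun=> 0) b1 (fun p => - b1 p) (fun=> 0)
    (fun p => - (1 / (2 * N + 1)) * (b0 p / (2 * N) + 2 * b1 p)).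

Definition pseudo_projective (b0 b1 : M -> R) : tcoef R M :=
  TCoef b0 b1 (fun p => - b1 p) (fun=> 0) (fun=> 0) (fun=> 0) (fun=> 0)
    (fun p => - (1 / (2 * N + 1)) * (b0 p / (2 * N) + b1 p)).

Definition conformal : tcoef R M :=
  let t := 1 / (2 * N - 1) in
  const 1 (- t) t 0 (- t) t 0 (1 / (2 * N * (2 * N - 1))).

Definition conharmonic : tcoef R M :=
  let t := 1 / (2 * N - 1) in const 1 (- t) t 0 (- t) t 0 0.

Definition concircular : tcoef R M :=
  const 1 0 0 0 0 0 0 (- (1 / (2 * N * (2 * N + 1)))).

Definition M_projective : tcoef R M :=
  let t := 1 / (4 * N) in const 1 (- t) t 0 (- t) t 0 0.

Local Notation s := (1 / (2 * N)).

Definition projective : tcoef R M := const 1 (- s) s 0 0 0 0 0.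
Definition W0 : tcoef R M := const 1 (- s) 0 0 0 s 0 0.
Definition W0_star : tcoef R M := const 1 s 0 0 0 (- s) 0 0.
Definition W1 : tcoef R M := const 1 s (- s) 0 0 0 0 0.
Definition W1_star : tcoef R M := const 1 (- s) s 0 0 0 0 0.
Definition W2 : tcoef R M := const 1 0 0 0 (- s) s 0 0.
Definition W3 : tcoef R M := const 1 0 (- s) 0 s 0 0 0.
Definition W4 : tcoef R M := const 1 0 0 0 0 s (- s) 0.
Definition W5 : tcoef R M := const 1 0 (- s) 0 0 s 0 0.
Definition W6 : tcoef R M := const 1 (- s) 0 0 0 0 s 0.
Definition W8 : tcoef R M := const 1 (- s) 0 s 0 0 0 0.
Definition W9 : tcoef R M := const 1 0 0 s (- s) 0 0 0.

End SpecialCoefficients.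

Arguments conformal R M n : clear implicits.
Arguments conharmonic R M n : clear implicits.
Arguments concircular R M n : clear implicits.
Arguments M_projective R M n : clear implicits.
Arguments projective R M n : clear implicits.
Arguments W0 R M n : clear implicits.
Arguments W0_star R M n : clear implicits.
Arguments W1 R M n : clear implicits.
Arguments W1_star R M n : clear implicits.
Arguments W2 R M n : clear implicits.
Arguments W3 R M n : clear implicits.
Arguments W4 R M n : clear implicits.
Arguments W5 R M n : clear implicits.
Arguments W6 R M n : clear implicits.
Arguments W8 R M n : clear implicits.
Arguments W9 R M n : clear implicits.

(* Quasi-flatness for the coefficients [c], when C1 does not vanish, gives the
   Ricci tensor b1 g + b2 eta (x) eta with M eta-Einstein, resp. b1 g with M
   Einstein. *)
Definition flat_eta_einstein (R : realType) (n m : nat) (M : topologicalType)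
    (A : manifold R m M) (phi : M -> 'M[R]_m) (eta : M -> 'cV[R]_m)
    (g : M -> 'M[R]_m)
    (Rm : M -> 'rV[R]_m -> 'rV[R]_m -> 'rV[R]_m -> 'rV[R]_m) (c : tcoef R M)
    (b1 b2 : M -> R) : Prop :=
  quasi_T_flat phi g Rm c -> (forall p, C1 n c p != 0) ->
  ricci_form eta g Rm b1 b2 /\ eta_einstein A eta g Rm.

Definition flat_einstein (R : realType) (n m : nat) (M : topologicalType)
    (A : manifold R m M) (phi : M -> 'M[R]_m) (eta : M -> 'cV[R]_m)
    (g : M -> 'M[R]_m)
    (Rm : M -> 'rV[R]_m -> 'rV[R]_m -> 'rV[R]_m -> 'rV[R]_m) (c : tcoef R M)
    (b1 : M -> R) : Prop :=
  quasi_T_flat phi g Rm c -> (forall p, C1 n c p != 0) ->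
  ricci_form eta g Rm b1 (fun=> 0) /\ einstein A eta g Rm.

(* Main.v *)
Require Import Defs.
From mathcomp Require Import ring lra.

(** Fix x and y and let T be the endomorphism X_1 |-> T(X_1, x) y of a tangent
    space.  Quasi-flatness says that T maps the contact distribution, the kernel
    of eta, into the line spanned by xi, because phi maps onto the contact
    distribution.  Hence tr T = eta (T xi) ([trace_horizontal]).  Both
    sides are computed term by term: the trace of X_1 |-> R(X_1, x) y is
    S(x, y), the trace of Q is r, and the other terms are multiples of the
    identity or of rank one; on the right, S(., xi) = 2 n kappa eta and
    eta (R(xi, x) y) = kappa (g(x, y) - eta(x) eta(y)).  The outcome is
    C_1 S = A_1 g + B_1 eta (x) eta ([T_mx_contraction], [quasi_T_flat_ricci]).

    The computation uses that R(X, Y) is skew for g and that S is symmetric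
    ([curvature_skew], [ricci_sym]).  Symmetry of S follows from the trace of
    the first Bianchi identity, since a skew endomorphism has trace zero.
    Skewness and the Bianchi identity are proved on the coordinate fields of a
    chart, which commute, so that in both cases the only analytic input is the
    symmetry of second derivatives ([derive_comm]).  That the coordinate fields
    are smooth rests on the stability of smooth maps under
    products and composition ([class_C_comp]).

    To say that M is eta-Einstein, the coefficients b_1 and b_2 must also be
    smooth, and they involve the scalar curvature.  They are determined by S:
    b_1 + b_2 = 2 n kappa, and b_1 is a quotient of smooth functions near each
    point ([ricci_form_eta_einstein]); this needs S(X, X) to be smooth
    ([ricci_chart_field_smooth]).

    The special cases follow by substituting the coefficients and
    r = 2 n (2 n - 2 + kappa). *)

Set Implicit Arguments.
Unset Strict Implicit.
Unset Printing Implicit Defensive.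

(** * Smooth maps between coordinate spaces *)

Section Calculus.
Context {R : realType} {m : nat}.
Local Notation V := ('rV[R]_m).
Implicit Types (A B : set V).

Lemma near_eq_differentiable {U W : normedModType R} (f g : U -> W) x :
  (\near x, f x = g x) -> differentiable f x -> differentiable g x.
Proof.
move=> fg df; have fgx : f x = g x by exact: (nbhs_singleton fg).
have fg0 : \forall y \near (0 : U), f (y + x) = g (y + x).
  by move: fg; rewrite (near_shift 0 x) /=; apply: filterS => y; rewrite subr0.
have gE : g \o shift x = cst (g x) + 'd f x +o_ 0 id.
  apply/eqaddoP => e e0.
  have /eqaddoP/(_ e e0) := diff_locally df.
  by apply: filterS2 fg0 => y /= Hy; rewrite -fgx !fctE /= Hy.
have dgf := diff_unique (diff_continuous df) gE.
by apply/diff_locallyP; rewrite dgf; split => //; exact: diff_continuous.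
Qed.

Lemma open_near_eq {W : Type} (f g : V -> W) A x :
  open A -> (forall y, A y -> f y = g y) -> A x -> \near x, f x = g x.
Proof. by move=> oA fg Ax; apply: filterS (open_nbhs_nbhs (conj oA Ax)). Qed.

(** The closure of [smooth_on] under products, inverses and composition does not
    follow by induction on the list of partials, since a partial of a product
    is a sum of products.  Being C^k with differentiable k-th partials, phrased by
    recursion on the innermost partial, is stable under these operations
    by induction on [k]. *)
Fixpoint class_C {W : normedModType R} (k : nat) (f : V -> W) A : Prop :=
  (forall x, A x -> differentiable f x) /\
  if k is k'.+1 then forall i, class_C k' ('D_(delta_mx 0 i) f) A else True.

Lemma class_C_diff {W : normedModType R} k (f : V -> W) A :
  class_C k f A -> forall x, A x -> differentiable f x.
Proof. by case: k => [|k] []. Qed.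

(** [iter_partial] adds its new derivative on the outside, [class_C] on the
    inside; this exchanges the two. *)
Lemma iter_partial_rcons {W : normedModType R} s i (f : V -> W) :
  iter_partial (rcons s i) f = iter_partial s ('D_(delta_mx 0 i) f).
Proof. by elim: s => //= j s ->. Qed.

Lemma smooth_onP {W : normedModType R} (f : V -> W) A :
  smooth_on f A <-> forall k, class_C k f A.
Proof.
split.
  move=> sf k; elim: k f sf => [|k IH] f sf /=.
    by split=> // x Ax; exact: (sf [::]).
  split=> [x Ax|i]; first exact: (sf [::]).
  by apply: IH => s x Ax; rewrite -iter_partial_rcons; exact: sf.
move=> cf s; move: (cf (size s)) => {cf}.
elim/last_ind: s f => [|s i IH] f /=; first by case.
by rewrite size_rcons iter_partial_rcons => -[_ /(_ i)]; exact: IH.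
Qed.

Lemma eq_class_C {W : normedModType R} k (f g : V -> W) A :
  open A -> (forall x, A x -> f x = g x) -> class_C k f A -> class_C k g A.
Proof.
move=> oA; elim: k f g => [|k IH] f g fg /= [df Hf]; split=> //.
- by move=> x Ax; apply: near_eq_differentiable (df x Ax); exact: open_near_eq fg Ax.
- by move=> x Ax; apply: near_eq_differentiable (df x Ax); exact: open_near_eq fg Ax.
- move=> i; apply: IH (Hf i) => x Ax.
  by apply: near_eq_derive; exact: open_near_eq fg Ax.
Qed.

Lemma class_CW {W : normedModType R} k (f : V -> W) A :
  class_C k.+1 f A -> class_C k f A.
Proof.
elim: k f => [|k IH] f /= [df Hf]; split=> // i.
by apply: IH; exact: Hf.
Qed.

Lemma class_C_cst {W : normedModType R} k (a : W) A : class_C k (cst a) A.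
Proof.
elim: k a => [|k IH] a; split=> // i.
by rewrite [X in class_C _ X](_ : _ = cst 0)//; apply/funext => x; rewrite derive_cst.
Qed.

Lemma class_C_D {W : normedModType R} k (f g : V -> W) A : open A ->
  class_C k f A -> class_C k g A -> class_C k (fun x => f x + g x) A.
Proof.
move=> oA; elim: k f g => [|k IH] f g /= [df Hf] [dg Hg]; split=> //.
- by move=> x Ax; exact: differentiableD (df x Ax) (dg x Ax).
- by move=> x Ax; exact: differentiableD (df x Ax) (dg x Ax).
- move=> i; apply: (@eq_class_C _ k _ _ _ oA _ (IH _ _ (Hf i) (Hg i))) => x Ax.
  by rewrite -deriveD //; apply: diff_derivable; [exact: df|exact: dg].
Qed.

Lemma class_C_N {W : normedModType R} k (f : V -> W) A : open A ->
  class_C k f A -> class_C k (fun x => - f x) A.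
Proof.
move=> oA; elim: k f => [|k IH] f /= [df Hf]; split=> //.
- by move=> x Ax; exact: differentiableN (df x Ax).
- by move=> x Ax; exact: differentiableN (df x Ax).
- move=> i; apply: (@eq_class_C _ k _ _ _ oA _ (IH _ (Hf i))) => x Ax.
  by rewrite -deriveN //; apply: diff_derivable; exact: df.
Qed.

Lemma class_C_sum {W : normedModType R} k n (f : 'I_n -> V -> W) A : open A ->
  (forall j, class_C k (f j) A) -> class_C k (fun x => \sum_j f j x) A.
Proof.
move=> oA; elim: n f => [|n IH] f Hf.
  by under eq_fun do rewrite big_ord0; exact: class_C_cst.
under eq_fun do rewrite big_ord_recl.
by apply: class_C_D => //; exact: IH.
Qed.

Lemma class_C_M k (f g : V -> R^o) A : open A ->
  class_C k f A -> class_C k g A -> class_C k (fun x => f x * g x : R^o) A.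
Proof.
move=> oA; elim: k f g => [|k IH] f g cf cg.
  split=> // x Ax; apply: differentiableM; first exact: (class_C_diff cf).
  exact: (class_C_diff cg).
split=> [x Ax|i].
  apply: differentiableM; first exact: (class_C_diff cf).
  exact: (class_C_diff cg).
have [df Hf] := cf; have [dg Hg] := cg.
apply: (@eq_class_C _ k _ _ _ oA _
  (class_C_D oA (IH _ _ (class_CW cf) (Hg i)) (IH _ _ (class_CW cg) (Hf i)))) => x Ax.
rewrite -[RHS]/('D_(delta_mx 0 i) (f * g) x).
by rewrite deriveM //; apply: diff_derivable; [exact: df|exact: dg].
Qed.

Lemma class_C_V k (f : V -> R^o) A : open A -> (forall x, A x -> f x != 0) ->
  class_C k f A -> class_C k (fun x => (f x)^-1 : R^o) A.
Proof.
move=> oA f0; elim: k => [|k IH] cf.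
  split=> // x Ax; apply: differentiableV; last exact: f0.
  exact: (class_C_diff cf).
split=> [x Ax|i].
  apply: differentiableV; last exact: f0.
  exact: (class_C_diff cf).
have [df Hf] := cf; have IHk := IH (class_CW cf).
apply: (@eq_class_C _ k _ _ _ oA _
  (class_C_N oA (class_C_M oA (class_C_M oA IHk IHk) (Hf i)))) => x Ax.
rewrite deriveV; [|exact: f0|by apply: diff_derivable; exact: df].
by rewrite -[LHS]mulNr -[in RHS]exprVn expr2.
Qed.

Lemma derive_coord (f : V -> V) x v j : differentiable f x ->
  'D_v (fun y => f y 0 j : R^o) x = ('D_v f x) 0 j.
Proof. by move=> df; rewrite derive_mx ?mxE//; exact: diff_derivable. Qed.

Lemma differentiable_coordP (f : V -> V) x :
  differentiable f x <-> forall j, differentiable (fun y => f y 0 j : R^o) x.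
Proof.
split=> [df j|df].
  exact: (differentiable_comp df (differentiable_coord (f x) 0 j)).
rewrite (_ : f = \sum_j (fun y => f y 0 j *: delta_mx 0 j)).
  by apply: differentiable_sum => j; exact: differentiableZl.
by apply/funext => y; rewrite {1}[f y]row_sum_delta fct_sumE.
Qed.

Lemma class_C_coordP k (f : V -> V) A : open A ->
  class_C k f A <-> forall j, class_C k (fun x => f x 0 j : R^o) A.
Proof.
move=> oA; elim: k f => [|k IH] f.
  split=> [[df _] j|cf]; split=> // x Ax.
    by move/differentiable_coordP: (df x Ax); exact.
  by apply/differentiable_coordP => j; case: (cf j) => + _; exact.
split=> [[df Hf] j|cf].
  split=> [x Ax|i]; first by move/differentiable_coordP: (df x Ax); exact.
  apply: (@eq_class_C _ k _ _ _ oA _ ((IH _).1 (Hf i) j)) => x Ax.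
  by rewrite derive_coord //; exact: df.
have df x : A x -> differentiable f x.
  by move=> Ax; apply/differentiable_coordP => j; case: (cf j) => + _; exact.
split=> // i; apply/IH => j; have [_ /(_ i)] := cf j.
by apply: eq_class_C => // x Ax; rewrite derive_coord //; exact: df.
Qed.

Lemma derive_partial {W : normedModType R} (f : V -> W) x v :
  differentiable f x -> 'D_v f x = \sum_j v 0 j *: 'D_(delta_mx 0 j) f x.
Proof.
move=> df; rewrite deriveE // {1}[v]row_sum_delta linear_sum.
by apply: eq_bigr => j _; rewrite linearZ /= deriveE.
Qed.

Lemma derive_comp {U U' W : normedModType R} (phi : U -> U') (f : U' -> W) x v :
  differentiable phi x -> differentiable f (phi x) ->
  'D_v (f \o phi) x = 'D_('D_v phi x) f (phi x).
Proof.
move=> dphi df; rewrite (deriveE _ (differentiable_comp dphi df)).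
rewrite (deriveE _ dphi) (deriveE _ df).
exact: (congr1 (fun h : U -> W => h v) (diff_comp dphi df)).
Qed.

(** By the chain rule a partial of [f \o phi] is the sum over [j] of the
    products ('D_i phi)_j * ('D_j f \o phi), whose factors are covered by the
    induction hypothesis and by the product rule. *)
Lemma class_C_comp k (phi : V -> V) (f : V -> R^o) A B : open A ->
  (forall x, A x -> B (phi x)) ->
  class_C k phi A -> class_C k f B -> class_C k (f \o phi) A.
Proof.
move=> oA AB; elim: k phi f AB => [|k IH] phi f AB cphi cf.
  split=> // x Ax.
  exact: (differentiable_comp (class_C_diff cphi Ax) (class_C_diff cf (AB x Ax))).
have dphi := class_C_diff cphi; have df := class_C_diff cf.
split=> [x Ax|i].
  exact: (differentiable_comp (dphi x Ax) (df _ (AB x Ax))).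
have cphi' := class_CW cphi; have [_ Hphi] := cphi; have [_ Hf] := cf.
have := class_C_sum oA (fun j => class_C_M oA
  ((class_C_coordP k _ oA).1 (Hphi i) j) (IH phi _ AB cphi' (Hf j))).
apply: eq_class_C => // x Ax.
rewrite (derive_comp _ (dphi x Ax) (df _ (AB x Ax))).
by rewrite [RHS]derive_partial //; apply: df; exact: AB.
Qed.

Lemma smooth_on_comp (phi : V -> V) (f : V -> R^o) A B : open A ->
  (forall x, A x -> B (phi x)) ->
  smooth_on phi A -> smooth_on f B -> smooth_on (f \o phi) A.
Proof.
move=> oA AB /smooth_onP cphi /smooth_onP cf; apply/smooth_onP => k.
exact: class_C_comp AB (cphi k) (cf k).
Qed.

Lemma smooth_on_coordP (f : V -> V) A : open A ->
  smooth_on f A <-> forall j, smooth_on (fun x => f x 0 j : R^o) A.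
Proof.
move=> oA; split=> [/smooth_onP cf j|cf].
  by apply/smooth_onP => k; exact: (class_C_coordP k f oA).1.
by apply/smooth_onP => k; apply/class_C_coordP => // j; move/smooth_onP: (cf j).
Qed.

Lemma smooth_on_comp_rV (phi f : V -> V) A B : open A -> open B ->
  (forall x, A x -> B (phi x)) ->
  smooth_on phi A -> smooth_on f B -> smooth_on (f \o phi) A.
Proof.
move=> oA oB AB sphi /(smooth_on_coordP _ oB) sf; apply/smooth_on_coordP => // j.
exact: smooth_on_comp AB sphi (sf j).
Qed.

Lemma eq_smooth_on {W : normedModType R} (f g : V -> W) A :
  open A -> (forall x, A x -> f x = g x) -> smooth_on f A -> smooth_on g A.
Proof.
move=> oA fg /smooth_onP cf; apply/smooth_onP => k; exact: eq_class_C fg (cf k).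
Qed.

Lemma smooth_on_derive v (f : V -> R^o) A : open A ->
  smooth_on f A -> smooth_on ('D_v f) A.
Proof.
move=> oA /smooth_onP cf; apply/smooth_onP => k.
have /= [df Hf] := cf k.+1.
apply: (@eq_class_C _ k _ _ _ oA _ (class_C_sum oA (fun j => class_C_M oA
  (class_C_cst k (v 0 j : R^o) A) (Hf j)))) => x Ax.
by rewrite [RHS]derive_partial //; exact: df.
Qed.

Lemma smooth_on_derive_rV v (f : V -> V) A : open A ->
  smooth_on f A -> smooth_on ('D_v f) A.
Proof.
move=> oA sf; apply/smooth_on_coordP => // j.
have sj := (smooth_on_coordP _ oA).1 sf j.
apply: eq_smooth_on (smooth_on_derive v oA sj) => // x Ax.
by rewrite derive_coord //; exact: (sf [::]).
Qed.

Lemma smooth_on_diff {W : normedModType R} (f : V -> W) A x :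
  smooth_on f A -> A x -> differentiable f x.
Proof. by move=> sf; exact: (sf [::]). Qed.

End Calculus.

(** * Symmetry of second derivatives *)

Section SecondDerivatives.
Context {R : realType} {V : normedModType R}.

Lemma is_derive_line (f : V -> R) (a w : V) (t : R) :
  differentiable f (t *: a + w) ->
  is_derive t (1 : R) (fun t => f (t *: a + w)) ('D_a f (t *: a + w)).
Proof.
move=> df.
have dl : is_diff t (fun t : R => t *: a + w) ( *:%R ^~ a).
  have -> : (fun t : R => t *: a + w) = ( *:%R ^~ a) + cst w by [].
  by apply: is_diff_eq; rewrite addr0.
have dlt := @ex_diff _ _ _ _ _ _ _ dl.
apply: DeriveDef.
  exact: diff_derivable (differentiable_comp dlt df).
rewrite [LHS](derive_comp _ dlt df) (deriveE _ dlt).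
by rewrite (@diff_val _ _ _ _ _ _ _ dl) scale1r.
Qed.

(* The second difference of [f] with steps [s *: a] and [s *: b]; it is
   symmetric in [a] and [b]. *)
Let Delta (f : V -> R) u a b s :=
  f (s *: a + (s *: b + u)) - f (s *: a + u) - f (s *: b + u) + f u.

(** The mean value theorem along [a] turns the second difference into s times
    an increment of ['D_a f] along [s *: b], and the differentiability of
    ['D_a f] at [u] estimates this increment. *)
Lemma second_difference (f : V -> R) (A : set V) u a b (e : R) :
  open A -> A u -> (forall x, A x -> differentiable f x) ->
  differentiable ('D_a f) u -> 0 < e ->
  exists2 d : R, 0 < d & forall s, 0 < s -> s < d ->
    `|Delta f u a b s - s ^+ 2 * 'D_b ('D_a f) u| <= e * s ^+ 2.
Proof.
move=> oA Au df dF e0; set F := 'D_a f.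
(* All the points met lie within s * K of u; e / (2 * K) is the relative
   error allowed for each of the two values of F. *)
pose K := `|a| + `|b| + 1; have K0 : 0 < K.
  by rewrite /K ltr_wpDl ?addr_ge0.
have e'0 : 0 < e / (2 * K) by rewrite divr_gt0 ?mulr_gt0.
have nA' : \forall h \near (0 : V), A (h + u).
  have : \forall y \near u, A y by exact: open_nbhs_nbhs.
  by rewrite (near_shift 0 u) /=; apply: filterS => y; rewrite subr0.
have nF : \forall h \near (0 : V),
    `|F (h + u) - (F u + 'd F u h)| <= e / (2 * K) * `|h|.
  have /eqaddoP/(_ _ e'0) := diff_locally dF.
  by apply: filterS => y; rewrite !fctE /=.
have nAF : \forall h \near (0 : V), A (h + u) /\
    `|F (h + u) - (F u + 'd F u h)| <= e / (2 * K) * `|h|.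
  by apply: filterS2 nA' nF.
have [d /= d0 Hd] := (nbhs_normP _ _).1 nAF.
exists (d / K); first by rewrite divr_gt0.
move=> s s0; rewrite ltr_pdivlMr // => sKd.
have small (t : R) (r : R) : 0 <= t <= s -> 0 <= r <= s ->
    `|t *: a + r *: b| <= s * K.
  move=> /andP[t0 ts] /andP[r0 rs].
  rewrite (le_trans (ler_normD _ _)) // !normrZ !ger0_norm //.
  rewrite /K mulrDr mulr1; apply: ler_wpDr; first exact: ltW.
  by rewrite mulrDr; apply: lerD; rewrite ler_wpM2r.
have ball (t : R) (r : R) : 0 <= t <= s -> 0 <= r <= s ->
    A (t *: a + r *: b + u) /\
    `|F (t *: a + r *: b + u) - (F u + 'd F u (t *: a + r *: b))|
      <= e / (2 * K) * (s * K).
  move=> Ht Hr; have /Hd [HA HF] : ball_ Num.norm 0 d (t *: a + r *: b).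
    by rewrite /ball_ /= sub0r normrN (le_lt_trans (small _ _ Ht Hr)).
  split=> //; apply: le_trans HF _.
  by apply: ler_wpM2l; [exact: ltW|exact: small].
pose phi t := f (t *: a + (s *: b + u)) - f (t *: a + u).
pose dphi t := F (t *: a + (s *: b + u)) - F (t *: a + u).
have s_s : 0 <= s <= s by apply/andP; split; [exact: ltW|].
have z_s : (0 : R) <= 0 <= s by apply/andP; split; [|exact: ltW].
have Hdf t : 0 <= t <= s -> is_derive t (1:R) phi (dphi t).
  move=> Ht; apply: is_deriveB; apply: is_derive_line; apply: df.
    by have [] := ball t s Ht s_s; rewrite addrA.
  by have [] := ball t 0 Ht z_s; rewrite scale0r addr0.
have [||c] := @MVT R phi dphi 0 s s0.
- by move=> t; rewrite in_itv /= => /andP[t0 ts]; apply: Hdf; rewrite !ltW.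
- apply: derivable_within_continuous => t; rewrite in_itv /= => /Hdf.
  by case.
rewrite in_itv /= => /andP[c0 cs].
have Hc : 0 <= c <= s by rewrite !ltW.
rewrite subr0 => Ephi.
have -> : Delta f u a b s = dphi c * s.
  by rewrite -Ephi /phi /Delta scale0r !add0r; ring.
have [_ H1] := ball c s Hc s_s; have [_ H2] := ball c 0 Hc z_s.
have HL : 'd F u (c *: a + s *: b) = 'd F u (c *: a) + s * 'D_b F u.
  by rewrite linearD [X in _ + X]linearZ (deriveE _ dF).
rewrite HL -addrA in H1; rewrite scale0r !addr0 in H2.
have -> : dphi c * s - s ^+ 2 * 'D_b F u =
  ((F (c *: a + (s *: b + u)) - (F u + ('d F u (c *: a) + s * 'D_b F u)))
  - (F (c *: a + u) - (F u + 'd F u (c *: a)))) * s.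
  by rewrite /dphi; ring.
rewrite normrM (gtr0_norm s0) expr2 mulrA.
apply: ler_wpM2r; first exact: ltW.
rewrite (le_trans (ler_normB _ _)) // (le_trans (lerD H1 H2)) //.
rewrite le_eqVlt; apply/orP; left; apply/eqP; field.
by rewrite gt_eqF.
Qed.

(** Young's theorem: both mixed derivatives are the limit of the same second
    difference divided by s^2. *)
Lemma derive_comm (f : V -> R) (A : set V) u a b :
  open A -> A u -> (forall x, A x -> differentiable f x) ->
  differentiable ('D_a f) u -> differentiable ('D_b f) u ->
  'D_b ('D_a f) u = 'D_a ('D_b f) u.
Proof.
move=> oA Au df da db; apply/eqP; rewrite -subr_eq0 -normr_le0.
apply/ler_addgt0Pl => e e0; rewrite addr0.
have e2 : 0 < e / 2 by rewrite divr_gt0.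
have [d1 d10 H1] := second_difference b oA Au df da e2.
have [d2 d20 H2] := second_difference a oA Au df db e2.
pose s := Num.min d1 d2 / 2.
have s0 : 0 < s by rewrite divr_gt0 // lt_min d10.
have m0 : 0 < Num.min d1 d2 by rewrite lt_min d10.
have sm : s < Num.min d1 d2 by rewrite /s; lra.
have {H1}H1 : _ := H1 s s0 (lt_le_trans sm _); rewrite ge_min lexx in H1.
have {H2}H2 : _ := H2 s s0 (lt_le_trans sm _); rewrite ge_min lexx orbT in H2.
have {}H1 := H1 isT; have {}H2 := H2 isT.
have DE : Delta f u b a s = Delta f u a b s.
  by rewrite /Delta addrCA; ring.
rewrite DE in H2.
have s2 : 0 < s ^+ 2 by rewrite exprn_gt0.
rewrite -(ler_pM2r s2) -{1}(gtr0_norm s2) -normrM.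
have -> : ('D_b ('D_a f) u - 'D_a ('D_b f) u) * s ^+ 2 =
  (Delta f u a b s - s ^+ 2 * 'D_a ('D_b f) u)
  - (Delta f u a b s - s ^+ 2 * 'D_b ('D_a f) u) by ring.
rewrite (le_trans (ler_normB _ _)) // (le_trans (lerD H2 H1)) //.
by rewrite le_eqVlt; apply/orP; left; apply/eqP; field.
Qed.
End SecondDerivatives.

(** * Coordinate fields of a chart *)

Lemma smooth_onS {R : realType} {m : nat} {W : normedModType R}
    (f : 'rV[R]_m -> W) (A B : set 'rV[R]_m) :
  A `<=` B -> smooth_on f B -> smooth_on f A.
Proof. by move=> AB sf s x /AB; exact: sf. Qed.

Lemma smooth_on_mixed {R : realType} {m : nat} (f : 'rV[R]_m -> R^o)
    (A : set 'rV[R]_m) a b u : open A -> A u -> smooth_on f A ->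
  'D_a ('D_b f) u = 'D_b ('D_a f) u.
Proof.
move=> oA Au sf; apply: (@derive_comm R _ f A) => //.
- by move=> x; exact: smooth_on_diff.
- exact: (smooth_on_diff (smooth_on_derive b oA sf)).
- exact: (smooth_on_diff (smooth_on_derive a oA sf)).
Qed.

Lemma smooth_on_mixed_rV {R : realType} {m : nat} (f : 'rV[R]_m -> 'rV[R]_m)
    (A : set 'rV[R]_m) a b u : open A -> A u -> smooth_on f A ->
  'D_a ('D_b f) u = 'D_b ('D_a f) u.
Proof.
move=> oA Au sf; apply/rowP => j.
have dd v w : ('D_v ('D_w f) u) 0 j = 'D_v ('D_w (fun y => f y 0 j : R^o)) u.
  rewrite -derive_coord; last exact: (smooth_on_diff (smooth_on_derive_rV w oA sf)).
  apply: near_eq_derive; apply: filterS (open_nbhs_nbhs (conj oA Au)) => y Ay.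
  by rewrite derive_coord //; exact: smooth_on_diff Ay.
apply: etrans (dd a b) _; apply: etrans _ (esym (dd b a)).
exact: (smooth_on_mixed a b oA Au ((smooth_on_coordP _ oA).1 sf j)).
Qed.

Section Charts.
Context {R : realType} {m : nat} {M : topologicalType} (A : manifold R m M).
Implicit Types (p q : M) (U : set M) (x y : 'rV[R]_m).

Lemma near_chart p q U : dom A p q -> open U -> U q ->
  \forall u \near coord A p q, (coord A p @` (dom A p `&` U)) u.
Proof.
move=> pq oU Uq.
have im : (coord A p @` dom A p) (coord A p q) by exists q.
have n1 : \forall u \near coord A p q, (coord A p @` dom A p) u.
  by apply: open_nbhs_nbhs; split=> //; exact: coord_open.
have n2 : \forall u \near coord A p q, U (inv A p u).
  apply: (inv_continuous im); rewrite coordK //.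
  exact: open_nbhs_nbhs.
apply: filterS2 n1 n2 => u [q' pq' <-]; rewrite coordK // => Uq'.
by exists q'.
Qed.

Lemma chart_open p U : open U -> open (coord A p @` (dom A p `&` U)).
Proof.
by move=> oU; rewrite openE => u [q [pq Uq] <-]; exact: near_chart.
Qed.

Lemma smooth_mapS {W : normedModType R} U U' (F : M -> W) :
  U `<=` U' -> smooth_map A U' F -> smooth_map A U F.
Proof.
move=> UU' sF p; apply: smooth_onS (sF p).
by move=> u [q [pq Uq] <-]; exists q => //; split=> //; exact: UU'.
Qed.

Lemma eq_smooth_map {W : normedModType R} U (F G : M -> W) : open U ->
  (forall q, U q -> F q = G q) -> smooth_map A U F -> smooth_map A U G.
Proof.
move=> oU FG sF p; apply: eq_smooth_on (sF p); first exact: chart_open.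
by move=> u [q [pq Uq] <-] /=; rewrite coordK //; exact: FG.
Qed.

Lemma coord_smooth p : smooth_map A (dom A p) (coord A p).
Proof. by move=> q; exact: transition_smooth. Qed.
#[local] Arguments coord_smooth p : clear implicits.

Lemma smooth_map_diff {W : normedModType R} U (F : M -> W) p q :
  smooth_map A U F -> dom A p q -> U q ->
  differentiable (F \o inv A p) (coord A p q).
Proof. by move=> sF pq Uq; apply: (smooth_on_diff (sF p)); exists q. Qed.

Lemma transition_diff p q r : dom A p r -> dom A q r ->
  differentiable (coord A q \o inv A p) (coord A p r).
Proof. move=> pr qr. exact: (smooth_map_diff (coord_smooth q) pr qr). Qed.

(** The coordinate field of the chart [coord A p] with constant components [x].
    Tangent vectors at [q] are read in the preferred chart at [q], hence the
    derivative of the transition map. *)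
Definition chart_field p x : M -> 'rV[R]_m :=
  fun q => 'd (coord A q \o inv A p) (coord A p q) x.

Lemma chart_fieldD p x y q :
  chart_field p (x + y) q = chart_field p x q + chart_field p y q.
Proof. exact: linearD. Qed.

Lemma chart_fieldZ p a x q : chart_field p (a *: x) q = a *: chart_field p x q.
Proof. exact: linearZ. Qed.

Lemma change_chart {W : Type} (F : M -> W) p q r : dom A p r -> dom A q r ->
  \forall u \near coord A p r,
  (F \o inv A p) u = ((F \o inv A q) \o (coord A q \o inv A p)) u.
Proof.
move=> pr qr; apply: filterS (near_chart pr (dom_open A q) qr).
by move=> u [s [ps qs] <-] /=; rewrite !coordK.
Qed.

Lemma chart_field_id p x : chart_field p x p = x.
Proof.
have dt := transition_diff (dom_center A p) (dom_center A p).
rewrite /chart_field -(deriveE _ dt) -[RHS](derive_id (coord A p p) x).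
apply: near_eq_derive.
apply: filterS (near_chart (dom_center A p) openT I) => u [q [pq _] <-].
by rewrite /= coordK.
Qed.

(** Differentiation along a coordinate field is a directional derivative in the
    chart; this reduces all that follows to calculus in one chart. *)
Lemma derive_change_chart {W : normedModType R} (F : M -> W) p q x :
  dom A p q -> differentiable (F \o inv A q) (coord A q q) ->
  'D_(chart_field p x q) (F \o inv A q) (coord A q q)
  = 'D_x (F \o inv A p) (coord A p q).
Proof.
move=> pq dF; have qq := dom_center A q; have dt := transition_diff pq qq.
have E : (coord A q \o inv A p) (coord A p q) = coord A q q by rewrite /= coordK.
rewrite (near_eq_derive _ (change_chart F pq qq)).
rewrite -E in dF *; rewrite (derive_comp _ dt dF).
by rewrite (deriveE _ dt).
Qed.

(** At every point of the chart the coordinate fields span the tangent space. *)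
Lemma chart_field_inverse p q y : dom A p q ->
  chart_field p ('d (coord A p \o inv A q) (coord A q q) y) q = y.
Proof.
move=> pq; have qq := dom_center A q; have dpq := transition_diff qq pq.
have dqp := transition_diff pq qq.
have E : (coord A p \o inv A q) (coord A q q) = coord A p q by rewrite /= coordK.
have dqp' : differentiable (coord A q \o inv A p)
    ((coord A p \o inv A q) (coord A q q)) by rewrite E.
have H := derive_comp y dpq dqp'.
rewrite (deriveE _ dqp') (deriveE _ dpq) E in H; apply: etrans (esym H) _.
have N := near_eq_derive y (change_chart (coord A q) qq pq).
apply: etrans (esym N) _; rewrite (deriveE _ (transition_diff qq qq)).
exact: chart_field_id.
Qed.

Lemma dirD_chart_field {W : normedModType R} U (F : M -> W) p x q :
  smooth_map A U F -> dom A p q -> U q ->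
  dirD A (chart_field p x) F q = 'D_x (F \o inv A p) (coord A p q).
Proof.
move=> sF pq Uq; apply: derive_change_chart => //.
exact: smooth_map_diff sF (dom_center A q) Uq.
Qed.

Lemma transition_sub p r U : 
  coord A r @` (dom A r `&` (dom A p `&` U)) `<=`
    coord A r @` (dom A r `&` dom A p).
Proof. by move=> u [q [? []]] *; exists q. Qed.

Lemma transition_maps p r U u :
  (coord A r @` (dom A r `&` (dom A p `&` U))) u ->
  (coord A p @` (dom A p `&` U)) ((coord A p \o inv A r) u).
Proof. by move=> [q [rq [pq Uq]] <-] /=; rewrite coordK //; exists q. Qed.

Lemma dirD_chart_field_smooth U (F : M -> R^o) p x : open U ->
  smooth_map A U F -> smooth_map A (dom A p `&` U) (dirD A (chart_field p x) F).
Proof.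
move=> oU sF r; have oDU := openI (dom_open A p) oU.
apply: (@eq_smooth_on _ _ _ ('D_x (F \o inv A p) \o (coord A p \o inv A r))).
- exact: chart_open.
- move=> u [q [rq [pq Uq]] <-] /=; rewrite (coordK rq).
  exact: (esym (dirD_chart_field x sF pq Uq)).
- apply: (smooth_on_comp (chart_open oDU) (@transition_maps p r U)).
    exact: (smooth_onS (@transition_sub p r U) (@transition_smooth _ _ _ A r p)).
  exact: smooth_on_derive (chart_open oU) (sF p).
Qed.
#[local] Arguments dirD_chart_field_smooth [U F] p x.

Lemma dirD_chart_field_smooth_rV U (F : M -> 'rV[R]_m) p x : open U ->
  smooth_map A U F -> smooth_map A (dom A p `&` U) (dirD A (chart_field p x) F).
Proof.
move=> oU sF r; have oDU := openI (dom_open A p) oU.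
apply: (@eq_smooth_on _ _ _ ('D_x (F \o inv A p) \o (coord A p \o inv A r))).
- exact: chart_open.
- move=> u [q [rq [pq Uq]] <-] /=; rewrite (coordK rq).
  exact: (esym (dirD_chart_field x sF pq Uq)).
- apply: (smooth_on_comp_rV (chart_open oDU) (chart_open oU) (@transition_maps p r U)).
    exact: (smooth_onS (@transition_sub p r U) (@transition_smooth _ _ _ A r p)).
  exact: smooth_on_derive_rV (chart_open oU) (sF p).
Qed.
#[local] Arguments dirD_chart_field_smooth_rV [U F] p x.

Lemma chart_field_smooth p x : smooth_field A (dom A p) (chart_field p x).
Proof.
move=> q; rewrite setIC; apply: dirD_chart_field_smooth_rV; first exact: dom_open.
exact: coord_smooth.
Qed.

Lemma dirD_chart_field2 {W : normedModType R} U (F : M -> W) p x y q : open U ->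
  smooth_map A U F ->
  smooth_map A (dom A p `&` U) (dirD A (chart_field p y) F) ->
  dom A p q -> U q ->
  dirD A (chart_field p x) (dirD A (chart_field p y) F) q
  = 'D_x ('D_y (F \o inv A p)) (coord A p q).
Proof.
move=> oU sF sdF pq Uq.
apply: etrans (dirD_chart_field x sdF pq (conj pq Uq)) _.
apply: near_eq_derive; apply: filterS (near_chart pq oU Uq) => u [r [pr Ur] <-] /=.
by rewrite (coordK pr); exact: dirD_chart_field sF pr Ur.
Qed.

Lemma dirD_chart_fieldC U (F : M -> R^o) p x y q : open U ->
  smooth_map A U F -> dom A p q -> U q ->
  dirD A (chart_field p x) (dirD A (chart_field p y) F) q
  = dirD A (chart_field p y) (dirD A (chart_field p x) F) q.
Proof.
move=> oU sF pq Uq.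
have s2 z := dirD_chart_field_smooth p z oU sF.
apply: etrans (dirD_chart_field2 x oU sF (s2 y) pq Uq) _.
apply: etrans _ (esym (dirD_chart_field2 y oU sF (s2 x) pq Uq)).
apply: (smooth_on_mixed x y (chart_open oU) _ (sF p)); by exists q.
Qed.

(** Coordinate fields commute because mixed partials do. *)
Lemma lie_bracket_chart_field p x y q : dom A p q ->
  lie_bracket A (chart_field p x) (chart_field p y) q = 0.
Proof.
move=> pq; have qq := dom_center A q; have oq := dom_open A q.
have sq := coord_smooth q.
have s2 z := dirD_chart_field_smooth_rV p z oq sq.
apply/eqP; rewrite subr_eq0; apply/eqP.
apply: etrans (dirD_chart_field2 x oq sq (s2 y) pq qq) _.
apply: etrans _ (esym (dirD_chart_field2 y oq sq (s2 x) pq qq)).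
apply: (smooth_on_mixed_rV x y (chart_open oq) _ (sq p)); by exists q.
Qed.

End Charts.

(** * Smooth functions on a manifold *)

Section ScalarMaps.
Context {R : realType} {m : nat} {M : topologicalType} (A : manifold R m M).

Lemma eq_dirD {W : normedModType R} X (F G : M -> W) U p : open U -> U p ->
  (forall q, U q -> F q = G q) -> dirD A X F p = dirD A X G p.
Proof.
move=> oU Up FG; apply: near_eq_derive.
apply: filterS (near_chart (dom_center A p) oU Up) => u [q [pq Uq] <-] /=.
by rewrite coordK //; exact: FG.
Qed.

Lemma dirDD {W : normedModType R} X (F G : M -> W) U p : U p ->
  smooth_map A U F -> smooth_map A U G ->
  dirD A X (fun q => F q + G q) p = dirD A X F p + dirD A X G p.
Proof.
move=> Up sF sG; rewrite /dirD -deriveD //; apply: diff_derivable.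
- exact: (smooth_map_diff sF (dom_center A p) Up).
- exact: (smooth_map_diff sG (dom_center A p) Up).
Qed.

Lemma smooth_map_cst {W : normedModType R} (a : W) U : smooth_map A U (cst a).
Proof. by move=> p; apply/smooth_onP => k; exact: class_C_cst. Qed.

Lemma smooth_mapD {W : normedModType R} U (F G : M -> W) : open U ->
  smooth_map A U F -> smooth_map A U G -> smooth_map A U (fun q => F q + G q).
Proof.
move=> oU sF sG p; apply/smooth_onP => k; apply: class_C_D; first exact: chart_open.
- exact: ((smooth_onP _ _).1 (sF p) k).
- exact: ((smooth_onP _ _).1 (sG p) k).
Qed.

Lemma smooth_mapN {W : normedModType R} U (F : M -> W) : open U ->
  smooth_map A U F -> smooth_map A U (fun q => - F q).
Proof.
move=> oU sF p; apply/smooth_onP => k; apply: class_C_N; first exact: chart_open.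
exact: ((smooth_onP _ _).1 (sF p) k).
Qed.

Lemma smooth_funM U (F G : M -> R) : open U ->
  smooth_fun A U F -> smooth_fun A U G -> smooth_fun A U (fun q => F q * G q).
Proof.
move=> oU sF sG p; apply/smooth_onP => k; apply: class_C_M; first exact: chart_open.
- exact: ((smooth_onP _ _).1 (sF p) k).
- exact: ((smooth_onP _ _).1 (sG p) k).
Qed.

Lemma smooth_funV U (F : M -> R) : open U -> (forall q, U q -> F q != 0) ->
  smooth_fun A U F -> smooth_fun A U (fun q => (F q)^-1).
Proof.
move=> oU F0 sF p; apply/smooth_onP => k; apply: class_C_V.
- exact: chart_open.
- by move=> u [q [pq Uq] <-] /=; rewrite coordK //; exact: F0.
- exact: ((smooth_onP _ _).1 (sF p) k).
Qed.

End ScalarMaps.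

(** * Symmetries of the curvature tensor *)

Section Curvature.
Context {R : realType} {m : nat} {M : topologicalType} {A : manifold R m M}
  {g : M -> 'M[R]_m} {nabla : (M -> 'rV[R]_m) -> (M -> 'rV[R]_m) -> (M -> 'rV[R]_m)}
  {Rm : M -> 'rV[R]_m -> 'rV[R]_m -> 'rV[R]_m -> 'rV[R]_m}.
Hypotheses (riem : riemannian A g) (LC : levi_civita A g nabla)
  (curv : curvature_tensor A nabla Rm).
Variable p : M.
Local Notation V := 'rV[R]_m.
Local Notation D := (dom A p).
Local Notation E := (chart_field A p).
Implicit Types (x y z w : V) (X Y Z : M -> V).

Let oD : open D := dom_open A p.
Let Dp : D p := dom_center A p.
Let sE x : smooth_field A D (E x) := chart_field_smooth x.

Lemma chart_field0 : E 0 = fun=> 0.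
Proof. by apply/funext => q; exact: linear0. Qed.

Let s0 : smooth_field A D (fun=> 0).
Proof. by rewrite -chart_field0; exact: sE. Qed.

Let N x y : M -> V := nabla (E x) (E y).

Let sN x y : smooth_field A D (N x y).
Proof. exact: nabla_smooth LC _ _ _ oD (sE x) (sE y). Qed.

Lemma nabla_chartDl x y Y q : smooth_field A D Y -> D q ->
  nabla (E (x + y)) Y q = nabla (E x) Y q + nabla (E y) Y q.
Proof.
move=> sY Dq; rewrite -(nablaDl LC oD (sE x) (sE y) sY Dq).
by congr (nabla _ _ _); apply/funext => r; exact: chart_fieldD.
Qed.

Lemma nabla_constZl a X Y q : smooth_field A D X -> smooth_field A D Y -> D q ->
  nabla (fun r => a *: X r) Y q = a *: nabla X Y q.
Proof.
move=> sX sY Dq.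
exact: (nablaZl LC oD (@smooth_map_cst _ _ _ A _ (a : R^o) D) sX sY Dq).
Qed.

Lemma nabla_constZr a X Y q : smooth_field A D X -> smooth_field A D Y -> D q ->
  nabla X (fun r => a *: Y r) q = a *: nabla X Y q.
Proof.
move=> sX sY Dq.
have := nabla_leibniz LC oD (@smooth_map_cst _ _ _ A _ (a : R^o) D) sX sY Dq.
by move=> ->; rewrite [dirD _ _ _ _]derive_cst scale0r add0r.
Qed.

Lemma nabla_chartZl a x Y q : smooth_field A D Y -> D q ->
  nabla (E (a *: x)) Y q = a *: nabla (E x) Y q.
Proof.
move=> sY Dq; rewrite -(nabla_constZl a (sE x) sY Dq).
by congr (nabla _ _ _); apply/funext => r; exact: chart_fieldZ.
Qed.

Lemma nabla_eq_r X Y Y' q : smooth_field A D X -> smooth_field A D Y ->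
  (forall r, D r -> Y r = Y' r) -> D q -> nabla X Y q = nabla X Y' q.
Proof. by move=> sX sY YY' Dq; apply: (nabla_local LC oD sX sY). Qed.

Lemma nabla0l Y q : smooth_field A D Y -> D q -> nabla (fun=> 0) Y q = 0.
Proof.
move=> sY Dq; rewrite -[RHS](scale0r (nabla (fun=> 0) Y q)).
rewrite -(nabla_constZl 0 s0 sY Dq).
by congr (nabla _ _ _); apply/funext => r; rewrite scale0r.
Qed.

(** The coordinate fields of a chart commute, so the bracket term of the
    curvature disappears. *)
Lemma curvature_chart_field x y z q : D q -> Rm q (E x q) (E y q) (E z q)
  = nabla (E x) (N y z) q - nabla (E y) (N x z) q.
Proof.
move=> Dq; rewrite (curv oD (sE x) (sE y) (sE z) Dq).
rewrite -[RHS]subr0; congr (_ - _); rewrite -(nabla0l (sE z) Dq).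
apply/esym; apply: (nabla_local LC oD s0 (sE z)) Dq => // r Dr.
by rewrite lie_bracket_chart_field.
Qed.

Lemma curvature_chartE x y z : Rm p x y z
  = nabla (E x) (N y z) p - nabla (E y) (N x z) p.
Proof. by rewrite -(curvature_chart_field _ _ _ Dp) !chart_field_id. Qed.

Lemma curvature_antisym x y z : Rm p x y z = - Rm p y x z.
Proof. by rewrite !curvature_chartE opprB. Qed.

Lemma curvatureD1 x x' y z : Rm p (x + x') y z = Rm p x y z + Rm p x' y z.
Proof.
rewrite !curvature_chartE (nabla_chartDl _ _ (sN y z) Dp).
rewrite (@nabla_eq_r _ _ (fun q => N x z q + N x' z q) _ (sE y) (sN _ z)) //.
  by rewrite (nablaDr LC oD (sE y) (sN x z) (sN x' z) Dp) opprD addrACA.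
by move=> r Dr; exact: nabla_chartDl (sE z) Dr.
Qed.

Lemma curvatureZ1 a x y z : Rm p (a *: x) y z = a *: Rm p x y z.
Proof.
rewrite !curvature_chartE (nabla_chartZl _ _ (sN y z) Dp).
rewrite (@nabla_eq_r _ _ (fun q => a *: N x z q) _ (sE y) (sN _ z)) //.
  by rewrite (nabla_constZr _ (sE y) (sN x z) Dp) scalerBr.
by move=> r Dr; exact: nabla_chartZl (sE z) Dr.
Qed.

Lemma curvatureD3 x y z z' : Rm p x y (z + z') = Rm p x y z + Rm p x y z'.
Proof.
have ND u : forall r, D r -> N u (z + z') r = N u z r + N u z' r.
  move=> r Dr; rewrite -(nablaDr LC oD (sE u) (sE z) (sE z') Dr).
  by congr (nabla _ _ _); apply/funext => s; exact: chart_fieldD.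
rewrite !curvature_chartE.
rewrite (nabla_eq_r (sE x) (sN y _) (ND y) Dp) (nabla_eq_r (sE y) (sN x _) (ND x) Dp).
rewrite (nablaDr LC oD (sE x) (sN y z) (sN y z') Dp).
by rewrite (nablaDr LC oD (sE y) (sN x z) (sN x z') Dp) opprD addrACA.
Qed.

Lemma curvatureZ3 a x y z : Rm p x y (a *: z) = a *: Rm p x y z.
Proof.
have NZ u : forall r, D r -> N u (a *: z) r = a *: N u z r.
  move=> r Dr; rewrite -(nabla_constZr _ (sE u) (sE z) Dr).
  by congr (nabla _ _ _); apply/funext => s; exact: chart_fieldZ.
rewrite !curvature_chartE.
rewrite (nabla_eq_r (sE x) (sN y _) (NZ y) Dp) (nabla_eq_r (sE y) (sN x _) (NZ x) Dp).
rewrite (nabla_constZr _ (sE x) (sN y z) Dp).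
by rewrite (nabla_constZr _ (sE y) (sN x z) Dp) scalerBr.
Qed.

(** For commuting fields the cyclic sum of nabla_X (nabla_Y Z - nabla_Z Y) is
    the cyclic sum of the curvature, and torsion-freeness makes each term
    vanish. *)
Lemma first_bianchi x y z : Rm p x y z + Rm p y z x + Rm p z x y = 0.
Proof.
have NC u v : forall r, D r -> N u v r = N v u r.
  move=> r Dr; apply/eqP; rewrite -subr_eq0; apply/eqP.
  by rewrite (nabla_torsion_free LC oD (sE u) (sE v) Dr) lie_bracket_chart_field.
have C u v w : nabla (E u) (N v w) p = nabla (E u) (N w v) p.
  exact: nabla_eq_r (sE u) (sN v w) (NC v w) Dp.
rewrite !curvature_chartE (C x z y) (C y x z) (C z y x).
by rewrite !subrKA subrr.
Qed.

(** Differentiate g(Z,W) twice, along X and Y in either order: metricity turns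
    the commutation of the two derivatives into the skewness of R(X,Y). *)
Lemma curvature_skew x y z w :
  form2 g p (Rm p x y z) w + form2 g p z (Rm p x y w) = 0.
Proof.
pose G (X Y : M -> V) : M -> R^o := fun q => form2 g q (X q) (Y q).
have sG X Y : smooth_field A D X -> smooth_field A D Y -> smooth_map A D (G X Y).
  by move=> sX sY; exact: metric_smooth riem _ _ _ oD sX sY.
have G1 u q : D q -> dirD A (E u) (G (E z) (E w)) q
    = G (N u z) (E w) q + G (E z) (N u w) q.
  by move=> Dq; exact: nabla_metric LC _ _ _ _ oD (sE u) (sE z) (sE w) _ Dq.
have G2 v u : dirD A (E v) (dirD A (E u) (G (E z) (E w))) p =
    form2 g p (nabla (E v) (N u z) p) w + form2 g p (N u z p) (N v w p)
    + (form2 g p (N v z p) (N u w p) + form2 g p z (nabla (E v) (N u w) p)).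
  apply: etrans (eq_dirD _ _ oD Dp (G1 u)) _.
  apply: etrans (dirDD _ Dp (sG _ _ (sN u z) (sE w)) (sG _ _ (sE z) (sN u w))) _.
  have := nabla_metric LC oD (sE v) (sN u z) (sE w) Dp.
  have := nabla_metric LC oD (sE v) (sE z) (sN u w) Dp.
  by rewrite !chart_field_id => H1 H2; congr (_ + _).
have := dirD_chart_fieldC x y oD (sG _ _ (sE z) (sE w)) Dp Dp.
rewrite !G2 !curvature_chartE.
have linl a b c : form2 g p (a - b) c = form2 g p a c - form2 g p b c.
  by rewrite /form2 !mulmxBl !mxE.
have linr a b c : form2 g p c (a - b) = form2 g p c a - form2 g p c b.
  by rewrite /form2 linearB mulmxBr !mxE.
by rewrite linl linr; lra.
Qed.

End Curvature.

(** * Endomorphisms mapping horizontal vectors to multiples of xi *)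

Section LinearAlgebra.
Context {R : realType} {m : nat}.
Implicit Types (x y u v xi : 'rV[R]_m) (eta c : 'cV[R]_m) (G B Q S : 'M[R]_m).

Local Notation pair B x y := ((x *m B *m y^T) 0 0).
Local Notation ev x c := ((x *m c) 0 0).

Lemma scale_ev x c v : ev x c *: v = x *m (c *m v).
Proof. by rewrite mulmxA -mul_scalar_mx -mx11_scalar. Qed.

Lemma tr_rank1 c v : \tr (c *m v) = ev v c.
Proof. by rewrite mxtrace_mulC trace_mx11. Qed.

(** This replaces the summation over an orthonormal frame of the contact
    distribution.  Let P = 1 - eta (x) xi be the projection onto the kernel of
    eta along xi.  If [T] maps horizontal vectors to multiples of xi, then
    P T P = 0, so tr (T P) = tr (P T P) = 0 and
    tr T = tr (T P) + tr (T (eta (x) xi)) = eta (T xi). *)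
Lemma trace_horizontal xi eta G (T : 'M[R]_m) :
  G \in unitmx -> G^T = G -> G *m xi^T = eta -> xi *m eta = 1%:M ->
  (forall u v, u *m eta = 0 -> v *m eta = 0 -> pair (T *m G) u v = 0) ->
  \tr T = ev (xi *m T) eta.
Proof.
move=> uG sG Gxi xe flat.
pose P := 1%:M - eta *m xi.
have Pe : P *m eta = 0 by rewrite mulmxBl mul1mx -mulmxA xe mulmx1 subrr.
have PP : P *m P = P by rewrite {2}/P mulmxBr mulmx1 mulmxA Pe mul0mx subr0.
have xiG : xi *m G = eta^T by rewrite -Gxi trmx_mul trmxK sG.
have GP : G *m P^T = P *m G.
  rewrite /P linearB /= trmx1 trmx_mul mulmxBr mulmxBl mulmx1 mul1mx mulmxA.
  by rewrite Gxi -mulmxA xiG.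
have H : P *m T *m P *m G = 0.
  apply/matrixP => i j; rewrite -[_ *m _ *m P *m G]mulmxA -GP mulmxA.
  have := flat (delta_mx 0 i *m P) (delta_mx 0 j *m P).
  rewrite -!mulmxA Pe !mulmx0 => /(_ erefl erefl).
  rewrite trmx_mul !mulmxA trmx_delta -!mulmxA -rowE mxE.
  by rewrite !mulmxA -colE !mxE.
have PTP : P *m T *m P = 0 by rewrite -[LHS](mulmxK uG) H mul0mx.
have : \tr (P *m T *m P) = 0 by rewrite PTP mxtrace0.
rewrite mxtrace_mulC mulmxA PP /P mulmxBl mul1mx linearB /= -[eta *m xi *m T]mulmxA tr_rank1.
by move/eqP; rewrite subr_eq0 => /eqP.
Qed.

Lemma pairC B x y : B^T = B -> pair B x y = pair B y x.
Proof.
by move=> sB; rewrite -[in LHS](trmxK (x *m B *m y^T)) mxE !trmx_mul trmxK sB mulmxA.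
Qed.

(** The matrix of X_1 |-> T(X_1, x) y, with [S] the Gram matrix of the Ricci
    tensor and [K] the matrix of X_1 |-> R(X_1, x) y. *)
Definition T_mx (a0 a1 a2 a3 a4 a5 a6 a7 r : R) G S Q (K : 'M[R]_m) x y : 'M[R]_m :=
  a0 *: K + (a1 * pair S x y)%:M + a2 *: (S *m y^T *m x) + a3 *: (S *m x^T *m y)
  + (a4 * pair G x y) *: Q + a5 *: (G *m y^T *m (x *m Q))
  + a6 *: (G *m x^T *m (y *m Q))
  + (a7 * r) *: ((pair G x y)%:M - G *m y^T *m x).

(** Equate tr T with eta (T xi) for T = X_1 |-> T(X_1, x) y.  The dimension is
    d + 1.  Every term of T other than a_0 R is a scalar, a multiple of Q or of
    rank one, so both sides are explicit. *)
Lemma T_mx_contraction a0 a1 a2 a3 a4 a5 a6 a7 r k d xi eta G S Q K x y :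
  G \in unitmx -> G^T = G -> G *m xi^T = eta -> xi *m eta = 1%:M ->
  S^T = S -> Q *m G = S -> S *m xi^T = (d * k) *: eta -> m%:R = d + 1 ->
  \tr Q = r -> \tr K = pair S x y ->
  ev (xi *m K) eta = k * (pair G x y - ev x eta * ev y eta) ->
  (forall u v, u *m eta = 0 -> v *m eta = 0 ->
     pair (T_mx a0 a1 a2 a3 a4 a5 a6 a7 r G S Q K x y *m G) u v = 0) ->
  (a0 + d * a1 + a2 + a3 + a5 + a6) * pair S x y
  = (a0 * k + a4 * (d * k - r) + a7 * r * (1 - d)) * pair G x y
    + (- (a0 * k) + d * k * (a2 + a3 + a5 + a6) - a7 * r) * (ev x eta * ev y eta).
Proof.
move=> uG sG Gxi xe sS QG Sxi md trQ trK Kxi flat.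
have xG (z : 'rV[R]_m) : pair G xi z = ev z eta by rewrite (pairC _ _ sG) -mulmxA Gxi.
have xS (z : 'rV[R]_m) : pair S xi z = d * k * ev z eta.
  by rewrite (pairC _ _ sS) -mulmxA Sxi -scalemxAr mxE.
have Qe (z : 'rV[R]_m) : ev (z *m Q) eta = d * k * ev z eta.
  have -> : z *m Q *m eta = z *m S *m xi^T.
    by rewrite -Gxi mulmxA -[z *m Q *m G]mulmxA QG.
  by rewrite -xS (pairC _ _ sS).
have e1 : ev xi eta = 1 by rewrite xe mxE.
have QS (u v : 'rV[R]_m) : pair (Q *m G) u v = pair S u v by rewrite QG.
have Syx : pair S y x = pair S x y by exact: pairC.
(* L vanishes on T; it is linear, so it can be evaluated term by term. *)
pose L (T : 'M[R]_m) := \tr T - ev (xi *m T) eta.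
have LD T U : L (T + U) = L T + L U.
  by rewrite /L mxtraceD mulmxDr mulmxDl mxE; ring.
have LZ b T : L (b *: T) = b * L T.
  by rewrite /L mxtraceZ -scalemxAr -scalemxAl mxE; ring.
have LN T : L (- T) = - L T by rewrite -scaleN1r LZ mulN1r.
have L1 b : L b%:M = b * d.
  rewrite /L mxtrace_scalar mul_mx_scalar -scalemxAl mxE e1 -mulr_natr md; ring.
have LR (c : 'cV[R]_m) (v : 'rV[R]_m) : L (c *m v) = ev v c - ev xi c * ev v eta.
  rewrite /L tr_rank1; congr (_ - _).
  by rewrite -scale_ev -scalemxAl mxE.
have LK : L K = pair S x y - k * (pair G x y - ev x eta * ev y eta).
  by rewrite /L trK Kxi.
have LQ : L Q = r - d * k by rewrite /L trQ Qe e1 mulr1.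
have e2 : L (S *m y^T *m x) = pair S x y - d * k * ev y eta * ev x eta.
  by rewrite LR !mulmxA xS.
have e3 : L (S *m x^T *m y) = pair S x y - d * k * ev x eta * ev y eta.
  by rewrite LR !mulmxA xS Syx.
have e5 : L (G *m y^T *m (x *m Q)) = pair S x y - ev y eta * (d * k * ev x eta).
  by rewrite LR !mulmxA xG Qe -QS !mulmxA.
have e6 : L (G *m x^T *m (y *m Q)) = pair S x y - ev x eta * (d * k * ev y eta).
  by rewrite LR !mulmxA xG Qe -Syx -QS !mulmxA.
have e7 : L (G *m y^T *m x) = pair G x y - ev y eta * ev x eta.
  by rewrite LR !mulmxA xG.
have : L (T_mx a0 a1 a2 a3 a4 a5 a6 a7 r G S Q K x y) = 0.
  by rewrite /L (trace_horizontal uG sG Gxi xe flat) subrr.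
rewrite /T_mx !LD !LZ LD LN !L1 LK LQ e2 e3 e5 e6 e7.
by move=> H; apply/eqP; rewrite -subr_eq0 -H; apply/eqP; ring.
Qed.

End LinearAlgebra.

(** * Symmetry of the Ricci tensor *)

Section LinearMaps.
Context {R : realType} {m : nat}.

Lemma linear_deltaE (W : lmodType R) (f : 'rV[R]_m -> W) x :
  (forall x y, f (x + y) = f x + f y) -> (forall a x, f (a *: x) = a *: f x) ->
  f x = \sum_j x 0 j *: f (delta_mx 0 j).
Proof.
move=> fD fZ; have f0 : f 0 = 0 by rewrite -(scale0r 0) fZ scale0r.
rewrite {1}[x]row_sum_delta (big_morph f fD f0).
by apply: eq_bigr => j _; exact: fZ.
Qed.

Lemma mul_lin1_mx n (f : 'rV[R]_m -> 'rV[R]_n) x :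
  (forall x y, f (x + y) = f x + f y) -> (forall a x, f (a *: x) = a *: f x) ->
  x *m lin1_mx f = f x.
Proof.
move=> fD fZ; rewrite mulmx_sum_row (linear_deltaE _ fD fZ).
by apply: eq_bigr => j _; congr (_ *: _); apply/rowP => k; rewrite !mxE.
Qed.

Lemma gram_mxE (B : 'rV[R]_m -> 'rV[R]_m -> R) x y :
  (forall x x' y, B (x + x') y = B x y + B x' y) ->
  (forall a x y, B (a *: x) y = a * B x y) ->
  (forall x y y', B x (y + y') = B x y + B x y') ->
  (forall a x y, B x (a *: y) = a * B x y) ->
  B x y = (x *m \matrix_(i, j) B (delta_mx 0 i) (delta_mx 0 j) *m y^T) 0 0.
Proof.
move=> BDl BZl BDr BZr; rewrite mxE.
rewrite (@linear_deltaE R^o (B x) y (BDr x) (fun a => BZr a x)).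
apply: eq_bigr => j _; rewrite !mxE [LHS]mulrC; congr (_ * _).
rewrite (@linear_deltaE R^o (B^~ (delta_mx 0 j)) x).
- by apply: eq_bigr => i _; rewrite !mxE.
- by move=> u v; exact: BDl.
- by move=> a u; exact: BZl.
Qed.

Lemma posdef_unitmx (G : 'M[R]_m) :
  (forall x : 'rV[R]_m, x != 0 -> 0 < (x *m G *m x^T) 0 0) -> G \in unitmx.
Proof.
move=> pos; rewrite -row_free_unit -kermx_eq0; apply/rowV0P => v.
move/sub_kermxP => vG; apply/eqP; apply: contraT => /pos.
by rewrite vG mul0mx mxE ltxx.
Qed.

Lemma form0_mx (C : 'M[R]_m) :
  (forall x y : 'rV[R]_m, (x *m C *m y^T) 0 0 = 0) -> C = 0.
Proof.
move=> C0; apply/matrixP => i j; have := C0 (delta_mx 0 i) (delta_mx 0 j).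
by rewrite -!rowE trmx_delta -colE !mxE.
Qed.

Lemma form_sym_mx (G : 'M[R]_m) :
  (forall x y : 'rV[R]_m, (x *m G *m y^T) 0 0 = (y *m G *m x^T) 0 0) -> G^T = G.
Proof.
move=> sG; apply/matrixP => i j; rewrite mxE.
have := sG (delta_mx 0 j) (delta_mx 0 i).
by rewrite -!rowE !trmx_delta -!colE !mxE.
Qed.

End LinearMaps.

Section Ricci.
Context {R : realType} {m : nat} {M : topologicalType} {A : manifold R m M}
  {g : M -> 'M[R]_m} {nabla : (M -> 'rV[R]_m) -> (M -> 'rV[R]_m) -> (M -> 'rV[R]_m)}
  {Rm : M -> 'rV[R]_m -> 'rV[R]_m -> 'rV[R]_m -> 'rV[R]_m}.
Hypotheses (riem : riemannian A g) (LC : levi_civita A g nabla)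
  (curv : curvature_tensor A nabla Rm).
Variable p : M.
Implicit Types (x y z w : 'rV[R]_m).

Lemma metric_unit : g p \in unitmx.
Proof. by apply: posdef_unitmx => x; exact: metric_pos riem p x. Qed.

Lemma metric_trmx : (g p)^T = g p.
Proof. by apply: form_sym_mx => x y; exact: metric_sym riem p x y. Qed.

Lemma curvatureD2 x y y' z : Rm p x (y + y') z = Rm p x y z + Rm p x y' z.
Proof.
rewrite (curvature_antisym LC curv) (curvatureD1 LC curv) opprD.
by rewrite -!(curvature_antisym LC curv).
Qed.

Lemma curvatureZ2 a x y z : Rm p x (a *: y) z = a *: Rm p x y z.
Proof.
rewrite (curvature_antisym LC curv) (curvatureZ1 LC curv) -scalerN.
by rewrite -(curvature_antisym LC curv).
Qed.

Lemma lin1_mxD n (f h : 'rV[R]_m -> 'rV[R]_n) :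
  lin1_mx (fun x => f x + h x) = lin1_mx f + lin1_mx h.
Proof. by apply/matrixP => i j; rewrite !mxE. Qed.

Lemma lin1_mxZ n a (f : 'rV[R]_m -> 'rV[R]_n) :
  lin1_mx (fun x => a *: f x) = a *: lin1_mx f.
Proof. by apply/matrixP => i j; rewrite !mxE. Qed.

Definition ricci_mx : 'M[R]_m :=
  \matrix_(i, j) ricci Rm p (delta_mx 0 i) (delta_mx 0 j).

Lemma ricciE x y : ricci Rm p x y = (x *m ricci_mx *m y^T) 0 0.
Proof.
apply: gram_mxE => [u u' v|a u v|u v v'|a u v]; rewrite /ricci.
- by under eq_fun do rewrite curvatureD2; rewrite lin1_mxD mxtraceD.
- by under eq_fun do rewrite curvatureZ2; rewrite lin1_mxZ mxtraceZ.
- by under eq_fun do rewrite (curvatureD3 LC curv); rewrite lin1_mxD mxtraceD.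
- by under eq_fun do rewrite (curvatureZ3 LC curv); rewrite lin1_mxZ mxtraceZ.
Qed.

Lemma trace_curvature x y : \tr (lin1_mx (Rm p x y)) = 0.
Proof.
pose B := lin1_mx (Rm p x y).
have BE z : z *m B = Rm p x y z.
  apply: mul_lin1_mx => [u v|a u]; first exact: curvatureD3 LC curv _ _ _ _ _.
  exact: curvatureZ3 LC curv _ _ _ _ _.
have skew : B *m g p + g p *m B^T = 0.
  apply: form0_mx => z w; have := curvature_skew riem LC curv p x y z w.
  rewrite -!BE /form2 trmx_mul mulmxDr mulmxDl !mulmxA => skewzw.
  by rewrite mxE.
have : \tr (B *m g p *m invmx (g p) + g p *m B^T *m invmx (g p)) = 0.
  by rewrite -mulmxDl skew mul0mx mxtrace0.
rewrite mulmxK ?metric_unit // mxtraceD [\tr (_ *m invmx _)]mxtrace_mulC.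
by rewrite mulKmx ?metric_unit // mxtrace_tr -/B; lra.
Qed.

(** Contract the first Bianchi identity in its first slot: the cyclic term
    R(y,z)x contributes the trace of a skew endomorphism, which vanishes. *)
Lemma ricci_sym x y : ricci Rm p x y = ricci Rm p y x.
Proof.
have : \tr (lin1_mx (fun z => Rm p z x y + Rm p x y z + Rm p y z x)) = 0.
  under eq_fun do rewrite (first_bianchi LC curv).
  by rewrite (_ : lin1_mx _ = 0) ?mxtrace0 //; apply/matrixP => i j; rewrite !mxE.
rewrite !lin1_mxD !mxtraceD trace_curvature addr0.
have -> : (fun z => Rm p y z x) = (fun z => (-1) *: Rm p z y x).
  by apply/funext => z; rewrite scaleN1r; exact: curvature_antisym LC curv _ _ _ _.
by rewrite lin1_mxZ mxtraceZ mulN1r => /eqP; rewrite subr_eq0 => /eqP.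
Qed.

Lemma ricci_mx_trmx : ricci_mx^T = ricci_mx.
Proof. by apply/matrixP => i j; rewrite !mxE ricci_sym. Qed.

End Ricci.

(** * The Ricci tensor of a quasi-flat contact metric manifold *)

Section ContactRicci.
Context {R : realType} {n : nat} {M : topologicalType}.
Local Notation m := (n.*2.+1).
Context {A : manifold R m M} {phi : M -> 'M[R]_m} {xi : M -> 'rV[R]_m}
  {eta : M -> 'cV[R]_m} {g : M -> 'M[R]_m}
  {nabla : (M -> 'rV[R]_m) -> (M -> 'rV[R]_m) -> (M -> 'rV[R]_m)}
  {Rm : M -> 'rV[R]_m -> 'rV[R]_m -> 'rV[R]_m -> 'rV[R]_m} {kappa : R}.
Hypotheses (contact : contact_metric A phi xi eta g) (LC : levi_civita A g nabla)
  (curv : curvature_tensor A nabla Rm) (Nk : N_contact xi eta Rm kappa).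
Implicit Types (p : M) (x y : 'rV[R]_m).

Let riem : riemannian A g := g_riemannian contact.
Let N : R := n%:R.

Lemma dim_natr : m%:R = 2 * N + 1 :> R.
Proof. by rewrite -muln2 -addn1 natrD natrM mulrC. Qed.

Lemma eta_metric p x : form2 g p x (xi p) = form1 eta p x.
Proof.
have := g_phi contact p x (xi p); rewrite (phi_xi contact) (eta_xi contact) mulr1.
by rewrite [X in X = _ -> _]/form2 trmx0 mulmx0 mxE => /esym/eqP; rewrite subr_eq0 => /eqP.
Qed.

Lemma metric_xi p : g p *m (xi p)^T = eta p.
Proof.
apply/colP => i; have := eta_metric p (delta_mx 0 i).
by rewrite /form2 /form1 -mulmxA -!rowE !mxE.
Qed.

Lemma xi_eta p : xi p *m eta p = 1%:M.
Proof. by rewrite [LHS]mx11_scalar; congr _%:M; exact: eta_xi contact p. Qed.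

(** The trace of x |-> kappa (eta(y) x - eta(x) y). *)
Lemma ricci_xi p y : ricci Rm p y (xi p) = 2 * N * kappa * form1 eta p y.
Proof.
rewrite /ricci.
have -> : (fun x => Rm p x y (xi p)) = (fun x => x *m
    (kappa *: ((form1 eta p y)%:M - eta p *m y))).
  apply/funext => x; rewrite Nk -scalemxAr mulmxBr mul_mx_scalar.
  by rewrite -scale_ev.
rewrite (_ : lin1_mx _ = kappa *: ((form1 eta p y)%:M - eta p *m y)).
  rewrite mxtraceZ linearB /= mxtrace_scalar tr_rank1 -[_ *+ n.*2.+1]mulr_natr dim_natr /form1.
  by ring.
by apply/matrixP => i j; rewrite mxE -rowE mxE.
Qed.

Lemma ricci_mx_xi p : ricci_mx (Rm:=Rm) p *m (xi p)^T = (2 * N * kappa) *: eta p.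
Proof.
apply/colP => i; have := ricci_xi p (delta_mx 0 i).
by rewrite (ricciE LC curv) /form1 -mulmxA -!rowE !mxE.
Qed.

Lemma curvature_xi_xi p x y : form1 eta p (Rm p (xi p) x y)
  = kappa * (form2 g p x y - form1 eta p x * form1 eta p y).
Proof.
rewrite -eta_metric; have := curvature_skew riem LC curv p (xi p) x y (xi p).
rewrite Nk (eta_xi contact) scale1r => /eqP; rewrite addr_eq0 => /eqP ->.
rewrite -[form1 eta p y]eta_metric (metric_sym riem p x y) /form2.
rewrite [_^T]linearZ /= [_^T]linearB /= [(_ *: xi p)^T]linearZ /=.
rewrite -scalemxAr mulmxBr -scalemxAr.
set a := _ *m (xi p)^T; set b := _ *m x^T.
by rewrite !mxE; ring.
Qed.

Lemma T_tensorE (c : tcoef R M) p x1 x2 x3 :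
  T_tensor g Rm c p x1 x2 x3 = x1 *m
    T_mx (a0 c p) (a1 c p) (a2 c p) (a3 c p) (a4 c p) (a5 c p) (a6 c p) (a7 c p)
      (scalar_curvature g Rm p) (g p) (ricci_mx (Rm:=Rm) p) (ricci_op g Rm p)
      (lin1_mx (fun x => Rm p x x2 x3)) x2 x3.
Proof.
rewrite /T_tensor /T_mx !(ricciE LC curv) /form2 /endo.
rewrite !mulmxDr -!scalemxAr !mul_mx_scalar mulmxBr mul_mx_scalar.
rewrite mul_lin1_mx; first last.
- by move=> a u; exact: curvatureZ1 LC curv _ _ _ _ _.
- by move=> u v; exact: curvatureD1 LC curv _ _ _ _ _.
rewrite -!scale_ev !scalerA !mulmxA.
by [].
Qed.

(** A horizontal vector [u] is phi (phi (- u)), so quasi-flatness says exactly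
    that T(u, x) y is orthogonal to the contact distribution for [u]
    horizontal, which is what the trace identity asks for. *)
Lemma quasi_T_flat_ricci (c : tcoef R M) p x y : quasi_T_flat phi g Rm c ->
  C1 n c p * ricci Rm p x y
  = A1 n kappa (scalar_curvature g Rm) c p * form2 g p x y
    + B1 n kappa (scalar_curvature g Rm) c p * (form1 eta p x * form1 eta p y).
Proof.
move=> flat.
have dK : m%:R = 2 * N + 1 :> R by exact: dim_natr.
have QG : ricci_op g Rm p *m g p = ricci_mx (Rm:=Rm) p.
  by rewrite /ricci_op mulmxKV // (metric_unit riem).
rewrite (ricciE LC curv).
apply: (T_mx_contraction (metric_unit riem p) (metric_trmx riem p)
  (metric_xi p) (xi_eta p) (ricci_mx_trmx riem LC curv p) QG (ricci_mx_xi p) dK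
  (erefl _) (K := lin1_mx (fun z => Rm p z x y))).
- by rewrite -(ricciE LC curv).
- rewrite mul_lin1_mx; first exact: curvature_xi_xi.
    by move=> u v; exact: curvatureD1 LC curv _ _ _ _ _.
  by move=> a u; exact: curvatureZ1 LC curv _ _ _ _ _.
- have phiK u : u *m eta p = 0 -> u = endo phi p (endo phi p (- u)).
    by move=> u0; rewrite (phi_sqr contact) opprK /form1 mulNmx u0 oppr0 mxE scale0r addr0.
  move=> u v /phiK -> /phiK ->; rewrite mulmxA -T_tensorE.
  exact: flat.
Qed.

End ContactRicci.

(** * Smoothness of the coefficients *)

Section LocalSmoothness.
Context {R : realType} {m : nat} {M : topologicalType} {A : manifold R m M}.

Lemma smooth_map_local {W : normedModType R} (F : M -> W) :
  (forall q, exists U, [/\ open U, U q & smooth_map A U F]) ->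
  smooth_map A setT F.
Proof.
move=> loc p s u [q [pq _] <-]; have [U [oU Uq sF]] := loc q.
by apply: (sF p); exists q.
Qed.

Lemma smooth_map_coord U (F : M -> 'rV[R]_m) j : open U ->
  smooth_map A U F -> smooth_fun A U (fun q => F q 0 j).
Proof.
move=> oU sF p; exact: ((smooth_on_coordP _ (chart_open oU)).1 (sF p) j).
Qed.

Lemma smooth_fun_sum U k (F : 'I_k -> M -> R) : open U ->
  (forall i, smooth_fun A U (F i)) -> smooth_fun A U (fun q => \sum_i F i q).
Proof.
move=> oU sF p; apply/smooth_onP => l.
apply: (@class_C_sum _ _ _ l k (fun i => (F i : M -> R^o) \o inv A p)).
  exact: chart_open.
by move=> i; exact: ((smooth_onP _ _).1 (sF i p) l).
Qed.

Lemma smooth_fun_neq0_open p (h : M -> R) :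
  smooth_fun A (dom A p) h -> open [set q | dom A p q /\ h q != 0].
Proof.
move=> sh; rewrite openE => q [pq hq].
have ch : {for coord A p q, continuous ((h : M -> R^o) \o inv A p)}.
  exact: differentiable_continuous (smooth_map_diff sh pq pq).
have cc : {for q, continuous (((h : M -> R^o) \o inv A p) \o coord A p)}.
  apply: continuous_comp ch; exact: coord_continuous.
have n1 : \forall r \near q, ((h : M -> R^o) \o inv A p \o coord A p) r != 0.
  by apply: (cvgr_neq0 _ cc) => /=; rewrite coordK.
have n2 : \forall r \near q, dom A p r.
  exact: open_nbhs_nbhs (conj (dom_open A p) pq).
by apply: filterS2 n1 n2 => r /= + pr; rewrite coordK.
Qed.

End LocalSmoothness.

Section RicciSmooth.
Context {R : realType} {m : nat} {M : topologicalType} {A : manifold R m M}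
  {g : M -> 'M[R]_m} {nabla : (M -> 'rV[R]_m) -> (M -> 'rV[R]_m) -> (M -> 'rV[R]_m)}
  {Rm : M -> 'rV[R]_m -> 'rV[R]_m -> 'rV[R]_m -> 'rV[R]_m}.
Hypotheses (LC : levi_civita A g nabla) (curv : curvature_tensor A nabla Rm).

(** The trace defining the Ricci tensor may be taken in the frame of a fixed
    chart: with [J] the derivative of the transition from that chart to the
    preferred one, it is the sum over [i] of the [i]-th components, in the
    chart, of R(E_i, X) X, and these are smooth. *)
Lemma ricci_chart_field_smooth p x :
  smooth_fun A (dom A p)
    (fun q => ricci Rm q (chart_field A p x q) (chart_field A p x q)).
Proof.
pose E := chart_field A p; have oD := dom_open A p.
have sE y : smooth_field A (dom A p) (E y) by exact: chart_field_smooth.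
have sN y z : smooth_field A (dom A p) (nabla (E y) (E z)).
  exact: nabla_smooth LC _ _ _ oD (sE y) (sE z).
pose e (i : 'I_m) : 'rV[R]_m := delta_mx 0 i.
pose Z1 i := nabla (E (e i)) (nabla (E x) (E x)).
pose Z2 i := nabla (E x) (nabla (E (e i)) (E x)).
have sZ1 i : smooth_field A (dom A p) (Z1 i).
  exact: nabla_smooth LC _ _ _ oD (sE _) (sN _ _).
have sZ2 i : smooth_field A (dom A p) (Z2 i).
  exact: nabla_smooth LC _ _ _ oD (sE _) (sN _ _).
pose F i q := (dirD A (Z1 i) (coord A p) q - dirD A (Z2 i) (coord A p) q) 0 i.
have sF : smooth_fun A (dom A p) (fun q => \sum_i F i q).
  apply: smooth_fun_sum => // i; apply: smooth_map_coord => //.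
  apply: smooth_mapD => //.
    by apply: smooth_mapS (sZ1 i p) => q.
  by apply: smooth_mapN => //; apply: smooth_mapS (sZ2 i p) => q.
apply: eq_smooth_map oD _ sF => q pq.
pose J := lin1_mx ('d (coord A q \o inv A p) (coord A p q)).
pose K := lin1_mx ('d (coord A p \o inv A q) (coord A q q)).
pose B := lin1_mx (fun y => Rm q y (E x q) (E x q)).
have KJ : K *m J = 1%:M.
  apply/row_matrixP => i; rewrite !rowE mulmxA !mul_rV_lin1 mulmx1.
  exact: chart_field_inverse.
have BE y : y *m B = Rm q y (E x q) (E x q).
  apply: mul_lin1_mx => [u v|a u]; first exact: curvatureD1 LC curv _ _ _ _ _.
  exact: curvatureZ1 LC curv _ _ _ _ _.
have dc : differentiable (coord A p \o inv A q) (coord A q q).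
  exact: transition_diff (dom_center A q) pq.
have DE (Y : M -> 'rV[R]_m) : dirD A Y (coord A p) q = Y q *m K.
  by rewrite mul_rV_lin1; exact: (deriveE _ dc).
have FE i : F i q = (J *m B *m K) i i.
  rewrite /F !DE -mulmxBl.
  rewrite -(curvature_chart_field LC curv _ _ _ pq) -/E -BE.
  have -> : E (e i) q = e i *m J by rewrite mul_rV_lin1.
  by rewrite -!mulmxA -rowE mxE !mulmxA.
under eq_bigr do rewrite FE.
by rewrite -/(\tr _) -mulmxA mxtrace_mulC -mulmxA KJ mulmx1.
Qed.

End RicciSmooth.

Section EtaEinstein.
Context {R : realType} {n : nat} {M : topologicalType}.
Local Notation m := (n.*2.+1).
Context {A : manifold R m M} {phi : M -> 'M[R]_m} {xi : M -> 'rV[R]_m}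
  {eta : M -> 'cV[R]_m} {g : M -> 'M[R]_m}
  {nabla : (M -> 'rV[R]_m) -> (M -> 'rV[R]_m) -> (M -> 'rV[R]_m)}
  {Rm : M -> 'rV[R]_m -> 'rV[R]_m -> 'rV[R]_m -> 'rV[R]_m} {kappa : R}.
Hypotheses (n_gt0 : (0 < n)%N)
  (contact : contact_metric A phi xi eta g) (LC : levi_civita A g nabla)
  (curv : curvature_tensor A nabla Rm) (Nk : N_contact xi eta Rm kappa).

Let riem : riemannian A g := g_riemannian contact.

Lemma horizontal_vector p : exists2 y : 'rV[R]_m, y != 0 & form1 eta p y = 0.
Proof.
have : kermx (eta p) != 0.
  rewrite kermx_eq0 /row_free neq_ltn.
  by rewrite (leq_ltn_trans (rank_leq_col _)) // ltnS double_gt0.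
move=> /rowV0Pn[y /sub_kermxP ye y0]; exists y => //.
by rewrite /form1 ye mxE.
Qed.

(** Smoothness of the coefficients is automatic.  S(xi,xi) = 2 n kappa gives
    b_1 + b_2 = 2 n kappa, so that
    S(X,X) - 2 n kappa eta(X)^2 = b_1 (g(X,X) - eta(X)^2) for every field X;
    near a point where X is horizontal and nonzero this can be solved for
    b_1. *)
Lemma ricci_form_eta_einstein b1 b2 :
  ricci_form eta g Rm b1 b2 -> eta_einstein A eta g Rm.
Proof.
move=> form; exists b1, b2; pose d := 2 * n%:R * kappa.
have b2E q : b2 q = d - b1 q.
  have := form q (xi q) (xi q); rewrite (ricci_xi Nk) (eta_metric contact).
  by rewrite (eta_xi contact) /d; lra.
suff sb1 : smooth_fun A setT b1.
  split=> //; apply: (@eq_smooth_map _ _ _ _ _ _ (fun q => d - b1 q : R^o)).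
  - exact: openT.
  - by move=> q _; rewrite b2E.
  - apply: smooth_mapD; [exact: openT|exact: smooth_map_cst|].
    by apply: smooth_mapN sb1; exact: openT.
apply: smooth_map_local => q.
have [y y0 ye] := horizontal_vector q.
pose X := chart_field A q y; have oD := dom_open A q.
have sX : smooth_field A (dom A q) X by exact: chart_field_smooth.
have Xq : X q = y by exact: chart_field_id.
pose h r := form2 g r (X r) (X r) - form1 eta r (X r) * form1 eta r (X r).
pose s r := ricci Rm r (X r) (X r) - d * (form1 eta r (X r) * form1 eta r (X r)).
have see : smooth_fun A (dom A q) (fun r => form1 eta r (X r) * form1 eta r (X r)).
  by apply: smooth_funM => //; exact: eta_smooth contact _ _ oD sX.
have sh : smooth_fun A (dom A q) h.
  apply: smooth_mapD => //; last by apply: smooth_mapN.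
  exact: (metric_smooth riem oD sX sX).
have ss : smooth_fun A (dom A q) s.
  apply: smooth_mapD => //; first exact: ricci_chart_field_smooth LC curv _ _.
  apply: smooth_mapN => //; apply: smooth_funM => //; exact: smooth_map_cst.
pose U := [set r | dom A q r /\ h r != 0].
have oU : open U by exact: smooth_fun_neq0_open.
have UD : U `<=` dom A q by move=> r [].
exists U; split=> //.
  split; first exact: dom_center.
  by rewrite /h Xq ye mul0r subr0 gt_eqF //; exact: metric_pos riem _ _ y0.
apply: (@eq_smooth_map _ _ _ _ _ _ (fun r => s r * (h r)^-1 : R^o)) => //.
  move=> r [_ hr]; rewrite /s form b2E; apply: (canLR (mulfK hr)).
  by rewrite /h; ring.
apply: smooth_funM => //; first exact: smooth_mapS UD ss.
apply: smooth_funV => //; first by move=> r [].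
exact: smooth_mapS UD sh.
Qed.

Lemma quasi_T_flat_eta_einstein (c : tcoef R M) :
  flat_eta_einstein n A phi eta g Rm c
    (fun p => A1 n kappa (scalar_curvature g Rm) c p / C1 n c p)
    (fun p => B1 n kappa (scalar_curvature g Rm) c p / C1 n c p).
Proof.
move=> flat C0; set b1 := fun p => _ / _; set b2 := fun p => _ / _.
have form : ricci_form eta g Rm b1 b2.
  move=> p x y; apply: (mulfI (C0 p)).
  rewrite (quasi_T_flat_ricci contact LC curv Nk p x y flat) /b1 /b2.
  by field; exact: C0.
by split=> //; exact: ricci_form_eta_einstein form.
Qed.

End EtaEinstein.

(** * Special tensors *)

Section SpecialCases.
Context {R : realType} {n : nat} {M : topologicalType}.
Local Notation m := (n.*2.+1).
Context {A : manifold R m M} {phi : M -> 'M[R]_m} {xi : M -> 'rV[R]_m}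
  {eta : M -> 'cV[R]_m} {g : M -> 'M[R]_m}
  {nabla : (M -> 'rV[R]_m) -> (M -> 'rV[R]_m) -> (M -> 'rV[R]_m)}
  {Rm : M -> 'rV[R]_m -> 'rV[R]_m -> 'rV[R]_m -> 'rV[R]_m} {kappa : R}.
Hypotheses (n_gt0 : (0 < n)%N)
  (contact : contact_metric A phi xi eta g) (LC : levi_civita A g nabla)
  (curv : curvature_tensor A nabla Rm) (Nk : N_contact xi eta Rm kappa).

Local Notation r := (scalar_curvature g Rm).

(** The equations are stated without dividing by C_1, so that no special case
    needs a normal form of 1 / C_1. *)
Lemma flat_eta_einstein_eq (c : tcoef R M) b1 b2 :
  (forall p, C1 n c p != 0 -> A1 n kappa r c p = b1 p * C1 n c p) ->
  (forall p, C1 n c p != 0 -> B1 n kappa r c p = b2 p * C1 n c p) ->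
  flat_eta_einstein n A phi eta g Rm c b1 b2.
Proof.
move=> e1 e2 flat C0.
have [form ee] := quasi_T_flat_eta_einstein n_gt0 contact LC curv Nk flat C0.
split=> // p x y; rewrite form e1 ?C0 // e2 ?C0 //.
by rewrite !mulfK ?C0.
Qed.

Lemma flat_einstein_eq (c : tcoef R M) (b : R) :
  (forall p, C1 n c p != 0 -> A1 n kappa r c p = b * C1 n c p) ->
  (forall p, C1 n c p != 0 -> B1 n kappa r c p = 0) ->
  flat_einstein n A phi eta g Rm c (fun=> b).
Proof.
move=> e1 e2 flat C0.
have [|form _] := @flat_eta_einstein_eq c (fun=> b) (fun=> 0) e1 _ flat C0.
  by move=> p /e2 ->; rewrite mul0r.
by split=> //; exists (fun=> b); split=> //; exact: smooth_map_cst.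
Qed.

End SpecialCases.

Unset Implicit Arguments.

Theorem theorem2 (R : realType) (n : nat) (hn : (0 < n)%N)
  (M : topologicalType) (A : manifold R n.*2.+1 M)
  (phi : M -> 'M[R]_(n.*2.+1)) (xi : M -> 'rV[R]_(n.*2.+1))
  (eta : M -> 'cV[R]_(n.*2.+1)) (g : M -> 'M[R]_(n.*2.+1))
  (contact : contact_metric A phi xi eta g)
  (nabla : (M -> 'rV[R]_(n.*2.+1)) -> (M -> 'rV[R]_(n.*2.+1)) ->
           (M -> 'rV[R]_(n.*2.+1)))
  (LC : levi_civita A g nabla)
  (Rm : M -> 'rV[R]_(n.*2.+1) -> 'rV[R]_(n.*2.+1) -> 'rV[R]_(n.*2.+1) ->
        'rV[R]_(n.*2.+1))
  (curv : curvature_tensor A nabla Rm)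
  (h : M -> 'M[R]_(n.*2.+1)) (h_def : half_lie_phi A phi xi h)
  (kappa : R) (Nk : N_contact xi eta Rm kappa) :
  let r := scalar_curvature g Rm in
  let N : R := n%:R in
  (forall c : tcoef R M, smooth_tcoef A c ->
     flat_eta_einstein n A phi eta g Rm c
       (fun p => A1 n kappa r c p / C1 n c p)
       (fun p => B1 n kappa r c p / C1 n c p))
  /\
  (standing_formulas n xi eta g h Rm kappa ->
   let eta_einstein_case c b1 b2 :=
     flat_eta_einstein n A phi eta g Rm c (fun=> b1) (fun=> b2) in
   let einstein_case c b1 := flat_einstein n A phi eta g Rm c (fun=> b1) in
   (forall b0 b1 : M -> R, smooth_fun A setT b0 -> smooth_fun A setT b1 ->
      flat_eta_einstein n A phi eta g Rm (quasi_conformal n b0 b1)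
        (fun p =>
           ((2 * N - 1) * (kappa + 2 * N - 2) * (4 * N * b1 p + b0 p)
              / (2 * N + 1)
            + b0 p * kappa - 4 * N * (N - 1) * b1 p)
           / (2 * b1 p * (N - 1) + b0 p))
        (fun p =>
           (kappa * (- (8 * N ^+ 2 * b1 p) - 2 * N * b0 p)
            + 2 * (N - 1) * (4 * N * b1 p + b0 p))
           / ((2 * N + 1) * (2 * b1 p * (N - 1) + b0 p)))) /\
   (eta_einstein_case (conformal R M n)
      (2 * N - 2) (2 * (N * kappa - N + 1))) /\
   (eta_einstein_case (conharmonic R M n)
      (kappa * (2 * N - 1) + 4 * N * (N - 1)) (2 * N * kappa + kappa)) /\
   (eta_einstein_case (concircular R M n)
      ((2 * N * (2 * N - 3 + 2 * kappa) + 2) / (2 * N + 1))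
      ((2 * N - 2 * N * kappa - 2) / (2 * N + 1))) /\
   (forall b0 b1 : M -> R, smooth_fun A setT b0 -> smooth_fun A setT b1 ->
      flat_eta_einstein n A phi eta g Rm (pseudo_projective n b0 b1)
        (fun p =>
           ((2 * N - 1) * (kappa + 2 * N - 2) * (2 * N * b1 p + b0 p)
              / (2 * N + 1)
            + kappa * b0 p)
           / (b1 p * (2 * N - 1) + b0 p))
        (fun p =>
           - (2 * ((kappa - 1) * N + 1) * (2 * N * b1 p + b0 p)
              / ((2 * N + 1) * (b1 p * (2 * N - 1) + b0 p))))) /\
   (einstein_case (projective R M n) (2 * N * kappa)) /\
   (einstein_case (W0 R M n) (2 * N * kappa)) /\
   (einstein_case (W1_star R M n) (2 * N * kappa)) /\
   (einstein_case (W6 R M n) (2 * N * kappa)) /\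
   (einstein_case (W8 R M n) (2 * N * kappa)) /\
   (einstein_case (M_projective R M n)
      (2 * N * (kappa + N - 1) / (N + 1))) /\
   (eta_einstein_case (W0_star R M n)
      (2 * N * kappa / (4 * N - 1)) (4 * N * kappa / (1 - 4 * N))) /\
   (eta_einstein_case (W1 R M n)
      (2 * N * kappa / (4 * N - 1)) (4 * N * kappa / (1 - 4 * N))) /\
   (einstein_case (W2 R M n)
      (2 * N * (2 * N - 2 + kappa) / (2 * N + 1))) /\
   (einstein_case (W9 R M n)
      (2 * N * (2 * N - 2 + kappa) / (2 * N + 1))) /\
   (eta_einstein_case (W3 R M n)
      (2 * N * (2 - 2 * N + kappa) / (2 * N - 1))
      (- (4 * N * kappa / (2 * N - 1)))) /\
   (eta_einstein_case (W4 R M n) kappa (- kappa)) /\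
   (eta_einstein_case (W5 R M n) kappa (- kappa))).
Proof.
move=> r N; split.
  by move=> c _; exact: quasi_T_flat_eta_einstein hn contact LC curv Nk c.
move=> SF eta_einstein_case einstein_case.
have rE p : scalar_curvature g Rm p = 2 * n%:R * (2 * n%:R - 2 + kappa).
  exact: scalar_formula SF p.
have N1 : 1 <= n%:R :> R by rewrite ler1n.
have N_neq0 : n%:R != 0 :> R by apply: lt0r_neq0; lra.
have ND1_neq0 : n%:R + 1 != 0 :> R by apply: lt0r_neq0; lra.
have N2D1_neq0 : 2 * n%:R + 1 != 0 :> R by apply: lt0r_neq0; lra.
have N2B1_neq0 : 2 * n%:R - 1 != 0 :> R by apply: lt0r_neq0; lra.
have N4B1_neq0 : 4 * n%:R - 1 != 0 :> R by apply: lt0r_neq0; lra.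
have N4Br1_neq0 : 1 - 4 * n%:R != 0 :> R by apply: ltr0_neq0; lra.
have nz := (N_neq0, ND1_neq0, N2D1_neq0, N2B1_neq0, N4B1_neq0, N4Br1_neq0).
have eta_case := flat_eta_einstein_eq hn contact LC curv Nk.
have ein_case := flat_einstein_eq hn contact LC curv Nk.
rewrite /eta_einstein_case /einstein_case /N.
refine (conj _ (conj _ (conj _ (conj _ (conj _ (conj _ (conj _ (conj _ (conj _ (conj _ (conj _ (conj _ (conj _ (conj _ (conj _ (conj _ (conj _ _))))))))))))))))).
- move=> b0 b1 _ _.
  have C1E p : C1 n (quasi_conformal n b0 b1) p = 2 * b1 p * (n%:R - 1) + b0 p.
    by rewrite /C1 /=; ring.
  apply: eta_case => p; rewrite C1E /A1 /B1 rE /= => C1_neq0.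
    by field; rewrite C1_neq0 !nz.
  by field; rewrite C1_neq0 !nz.
- by apply: eta_case => p _; rewrite /A1 /B1 /C1 rE /=; field; rewrite !nz.
- by apply: eta_case => p _; rewrite /A1 /B1 /C1 rE /=; field; rewrite !nz.
- by apply: eta_case => p _; rewrite /A1 /B1 /C1 rE /=; field; rewrite !nz.
- move=> b0 b1 _ _.
  have C1E p : C1 n (pseudo_projective n b0 b1) p = b1 p * (2 * n%:R - 1) + b0 p.
    by rewrite /C1 /=; ring.
  apply: eta_case => p; rewrite C1E /A1 /B1 rE /= => C1_neq0.
    by field; rewrite C1_neq0 !nz.
  by field; rewrite C1_neq0 !nz.
- by apply: ein_case => p _; rewrite /A1 /B1 /C1 rE /=; field; rewrite !nz.
- by apply: ein_case => p _; rewrite /A1 /B1 /C1 rE /=; field; rewrite !nz.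
- by apply: ein_case => p _; rewrite /A1 /B1 /C1 rE /=; field; rewrite !nz.
- by apply: ein_case => p _; rewrite /A1 /B1 /C1 rE /=; field; rewrite !nz.
- by apply: ein_case => p _; rewrite /A1 /B1 /C1 rE /=; field; rewrite !nz.
- by apply: ein_case => p _; rewrite /A1 /B1 /C1 rE /=; field; rewrite !nz.
- by apply: eta_case => p _; rewrite /A1 /B1 /C1 rE /=; field; rewrite !nz.
- by apply: eta_case => p _; rewrite /A1 /B1 /C1 rE /=; field; rewrite !nz.
- by apply: ein_case => p _; rewrite /A1 /B1 /C1 rE /=; field; rewrite !nz.
- by apply: ein_case => p _; rewrite /A1 /B1 /C1 rE /=; field; rewrite !nz.
- by apply: eta_case => p _; rewrite /A1 /B1 /C1 rE /=; field; rewrite !nz.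
- by apply: eta_case => p _; rewrite /A1 /B1 /C1 rE /=; field; rewrite !nz.
- by apply: eta_case => p _; rewrite /A1 /B1 /C1 rE /=; field; rewrite !nz.
Qed.
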